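(* For all $n$, the $h^*$-vectors of $B_n(132,312)$ and $\widetilde B_n(123)$ are palindromic.
   Context: $M_\sigma$ is the permutation matrix of $\sigma$. $B_n(132,312)$ is the convex hull of $M_\sigma$ over $\sigma\in\mathfrak S_n$ avoiding $132$ and $312$; $\widetilde B_n(123)$ is the convex hull of $M_\sigma$ over alternating ($a_1<a_2>a_3<\cdots$) $123$-avoiding $\sigma=a_1\cdots a_n\in\mathfrak S_n$. The $h^*$-vector $(h^*_0,\dots,h^*_d)$ of a lattice polytope $P$ (with $h^*_d\ne0$) is the coefficient vector of the polynomial $h^*_P(t)$ satisfying $1+\sum_{m\ge1}|mP\cap\mathbb Z^{n\times n}|\,t^m=h^*_P(t)/(1-t)^{\dim P+1}$; it is palindromic if $h^*_i=h^*_{d-i}$ for all $i$. *)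

(* Defs.v *)
From mathcomp Require Import all_boot all_order all_algebra perm finmap.
From mathcomp Require Import boolp classical_sets cardinality reals convex.

Set Implicit Arguments.
Unset Strict Implicit.
Unset Printing Implicit Defensive.

Import Order.TTheory GRing.Theory Num.Theory.

Local Open Scope classical_set_scope.
Local Open Scope ring_scope.

(* Permutations of {0, ..., n-1}; [s i] is the (i+1)-st letter of the word of
   [s], shifted down by one. *)

(* A pattern is written as the word of its letters; an occurrence in [s] is the
   increasing choice [f] of positions of an order-isomorphic subsequence. *)
Definition contains_pattern (n : nat) (s : 'S_n) (p : seq nat) : bool :=
  [exists f : {ffun 'I_(size p) -> 'I_n},
    [forall i : 'I_(size p), forall j : 'I_(size p),
       ((i < j)%N ==> (f i < f j)%N)
       && ((s (f i) < s (f j))%N == (nth 0%N p i < nth 0%N p j)%N)]].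

Definition avoids (n : nat) (s : 'S_n) (p : seq nat) : bool :=
  ~~ contains_pattern s p.

(* a_1 < a_2 > a_3 < ... ; positions are numbered from 0, so that the ascents
   are at the even positions. *)
Definition alternating (n : nat) (s : 'S_n) : bool :=
  [forall i : 'I_n, forall j : 'I_n,
     (j == i.+1 :> nat) ==> (if odd i then s j < s i else s i < s j)%N].

Definition conv_hull (R : realType) (V : lmodType R) (X : set V) : set V :=
  smallest (@convex_set R V) X.

Definition perm_polytope (R : realType) (n : nat) (X : {set 'S_n}) :
    set 'M[R]_n :=
  conv_hull [set (perm_mx s : 'M[R]_n) | s in [set` X]].
Arguments perm_polytope : clear implicits.

Definition B_132_312 (R : realType) (n : nat) : set 'M[R]_n :=
  perm_polytope R n
    [set s : 'S_n | avoids s [:: 1; 3; 2]%N && avoids s [:: 3; 1; 2]%N]%SET.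
Arguments B_132_312 : clear implicits.

Definition Btilde_123 (R : realType) (n : nat) : set 'M[R]_n :=
  perm_polytope R n
    [set s : 'S_n | alternating s && avoids s [:: 1; 2; 3]%N]%SET.
Arguments Btilde_123 : clear implicits.

(* The dimension of the affine hull of [P]: the largest [k] such that [P]
   contains [k + 1] affinely independent points [x0], [x0 + X_1], ...,
   [x0 + X_k] (and 0 when [P] is empty). *)
Definition affine_dim (R : realType) (V : vectType R) (P : set V) : nat :=
  \big[maxn/0%N]_(k < (\dim {:V}).+1 | `[< exists x0 : V, exists X : k.-tuple V,
     [/\ P x0, forall x, x \in X -> P (x0 + x) & free X] >]) k.

(* [fset_set] is the intended set only for finite sets; a bounded set has
   finitely many lattice points. *)
Definition lattice_points (R : realType) (n : nat) (P : set 'M[R]_n) (m : nat) :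
    nat :=
  #|` fset_set [set A : 'M[int]_n |
       [set m%:R *: x | x in P] (map_mx (intr : int -> R) A)] |.

Definition ehrhart_coef (R : realType) (n : nat) (P : set 'M[R]_n) (m : nat) :
    int :=
  if m is 0%N then 1 else (lattice_points P m)%:Z.

(* 1 + \sum_(m >= 1) |mP \cap Z^(n x n)| t^m = h(t) / (1 - t)^(dim P + 1) as
   formal power series, with the invertible denominator moved to the left. The
   coefficient of t^k only depends on the series truncated after t^k. Since the
   left-hand side is then an integral power series, so is h. *)
Definition is_hstar_poly (R : realType) (n : nat) (P : set 'M[R]_n)
    (h : {poly int}) : Prop :=
  forall k : nat,
    ((1 - 'X) ^+ (affine_dim P).+1
       * \poly_(m < k.+1) ehrhart_coef P m)`_k = h`_k.

Lemma is_hstar_poly_unique (R : realType) (n : nat) (P : set 'M[R]_n)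
    (h1 h2 : {poly int}) :
  is_hstar_poly P h1 -> is_hstar_poly P h2 -> h1 = h2.
Proof. by move=> H1 H2; apply/polyP => k; rewrite -H1 -H2. Qed.

(* The vector is (h_0, ..., h_d) with d = deg h = (size h).-1. *)
Definition palindromic (h : {poly int}) : Prop :=
  forall i : nat, (i <= (size h).-1)%N -> h`_i = h`_((size h).-1 - i).

Definition has_palindromic_hstar (R : realType) (n : nat) (P : set 'M[R]_n) :
    Prop :=
  exists h : {poly int}, is_hstar_poly P h /\ palindromic h.

(* Main.v *)
Require Import Defs.
From mathcomp Require Import boolp classical_sets cardinality reals convex.
From mathcomp Require Import interval_inference.
From mathcomp Require Import all_boot all_order all_algebra perm finmap.
From mathcomp Require Import zify ring lra.

Set Implicit Arguments.
Unset Strict Implicit.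
Unset Printing Implicit Defensive.

Import Order.TTheory GRing.Theory Num.Theory.

Local Open Scope ring_scope.

(* Both families of permutations are encoded by lattice paths with steps 0 and 1,
   that is, by the filters of a poset of cells, and the permutation matrix is an
   affine function of the indicator of the filter which maps integral points to
   integral points in both directions. So both polytopes are order polytopes up
   to a unimodular change of coordinates, their dimension is the number N of
   cells, and the lattice points of the m-th dilate are the order-preserving maps
   into {0, ..., m}.

   Order-preserving maps are multichains of filters, counted by the entries of
   the powers of the zeta matrix Z. As (Z - 1)^(N+1) = 0, the Ehrhart series has
   a polynomial numerator, whose coefficients can be rewritten in terms of the
   powers of Z^-1. Up to signs Z^-1 counts the multichains that encode strictly
   order-preserving maps. The two posets are graded, and subtracting the rank
   turns strictly order-preserving maps into order-preserving ones, which gives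
   the symmetry of the numerator. *)

(** * Counting order-preserving maps *)

Lemma coef_exp1subX (n i : nat) :
  ((1 - 'X) ^+ n : {poly int})`_i = (-1) ^+ i * ('C(n, i))%:R.
Proof.
elim: n i => [|n IH] i.
  by rewrite expr0 coef1 bin0n; case: i => [|i]; rewrite ?mulr1 ?mulr0.
rewrite exprS mulrBl mul1r coefB coefXM !IH; case: i => [|i] /=.
  by rewrite !bin0 subr0.
by rewrite binS natrD mulrDr exprS; ring.
Qed.

Lemma coef_exp1subX_poly (n k : nat) (e : nat -> int) :
  ((1 - 'X) ^+ n * \poly_(m < k.+1) e m)`_k =
  \sum_(i < k.+1) (-1) ^+ i * ('C(n, i))%:R * e (k - i)%N.
Proof.
rewrite coefM; apply: eq_bigr => i _.
by rewrite coef_exp1subX coef_poly ltnS leq_subr.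
Qed.

(** * Reciprocity for the powers of a unipotent ring element *)

Section Reciprocity.
Variables (A : pzRingType) (Z T : A) (N : nat).
Hypothesis ZT : Z * T = 1.
Hypothesis nilZ : (Z - 1) ^+ N.+1 = 0.

Lemma exprMV i j : (j <= i)%N -> Z ^+ i * T ^+ j = Z ^+ (i - j).
Proof.
elim: j i => [|j IH] [|i] //= ij; rewrite ?expr0 ?mulr1 ?subn0 //.
by rewrite exprSr exprS -mulrA [Z * (T * _)]mulrA ZT mul1r IH.
Qed.

Lemma exprVM i j : (i <= j)%N -> Z ^+ i * T ^+ j = T ^+ (j - i).
Proof.
elim: i j => [|i IH] [|j] //= ij; rewrite ?expr0 ?mul1r ?subn0 //.
by rewrite exprSr exprS -mulrA [Z * (T * _)]mulrA ZT mul1r IH.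
Qed.

Lemma nilpotent_expansion :
  \sum_(0 <= i < N.+2) (-1) ^+ i * Z ^+ (N.+1 - i) *+ 'C(N.+1, i) = 0.
Proof.
rewrite big_mkord -[RHS]nilZ exprBn_comm; last exact: commr1.
by apply: eq_bigr => i _; rewrite expr1n mulr1.
Qed.

(** The coefficient of [t^k] in [(1 - t)^(N+1)] times the series of all [Z^(m+1) t^m]. The exponent
    is [m + 1] because maps into [{0, ..., m}] are counted by an entry of [Z^(m+1)]. *)
Definition numer (k : nat) : A :=
  \sum_(0 <= i < k.+1) (-1) ^+ i * Z ^+ (k - i).+1 *+ 'C(N.+1, i).

(** The binomials vanish for [i > N + 1], and what remains is [(Z - 1)^(N+1) Z^(k-N)]. *)
Lemma numer_large k : (N < k)%N -> numer k = 0.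
Proof.
move=> Nk; rewrite /numer (@big_cat_nat _ _ _ N.+2) //=.
rewrite [X in _ + X]big_nat_cond [X in _ + X]big1 => [|i]; last first.
  by move=> /andP[/andP[Ni _] _]; rewrite bin_small.
have := congr1 (fun x => x * Z ^+ (k - N)%N) nilpotent_expansion.
rewrite mul0r addr0 => E; rewrite -[RHS]E mulr_suml [LHS]big_nat_cond [RHS]big_nat_cond.
apply: eq_bigr => i /andP[/andP[_ iN] _].
rewrite mulrnAl -mulrA -exprD; congr (_ * Z ^+ _ *+ _); lia.
Qed.

(* Multiply the expansion of [(Z - 1) ^+ N.+1 = 0] by [T ^+ (N - k)] and split it
   at [i = k]. *)
Lemma numer_small k : (k <= N)%N -> numer k = (-1) ^+ N *
  \sum_(0 <= i < (N - k).+1) (-1) ^+ i * T ^+ (N - k - i) *+ 'C(N.+1, i).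
Proof.
move=> kN; have := nilpotent_expansion.
rewrite (@big_cat_nat _ _ _ k.+1) //=; last by lia.
move/(congr1 (fun x => x * T ^+ (N - k)%N)); rewrite mul0r mulrDl => /eqP.
rewrite addr_eq0 => /eqP.
have -> : (\sum_(0 <= i < k.+1) (-1) ^+ i * Z ^+ (N.+1 - i) *+ 'C(N.+1, i)) *
    T ^+ (N - k)%N = numer k.
  rewrite mulr_suml [LHS]big_nat_cond [RHS]big_nat_cond.
  apply: eq_bigr => i /andP[/andP[_ ik] _].
  rewrite mulrnAl -mulrA exprMV; last by lia.
  by congr (_ * Z ^+ _ *+ _); lia.
move->; rewrite mulr_suml mulr_sumr -sumrN.
rewrite -{1}[k.+1]add0n big_addn.
have -> : (N.+2 - k.+1 = (N - k).+1)%N by lia.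
rewrite [LHS]big_nat_rev /= add0n.
rewrite [LHS]big_nat_cond [RHS]big_nat_cond.
apply: eq_bigr => i /andP[/andP[_ ik] _].
rewrite mulrnAl -mulrA exprVM; last by lia.
rewrite mulrnAr mulrA -exprD -mulNrn -mulNr -mulN1r -exprS.
have -> : 'C(N.+1, (N - k).+1 - i.+1 + k.+1) = 'C(N.+1, i).
  by rewrite -bin_sub; [congr 'C(_, _)|]; lia.
have -> : (-1) ^+ ((N - k).+1 - i.+1 + k.+1).+1 = (-1) ^+ (N + i) :> A.
  by rewrite -signr_odd -[RHS]signr_odd; congr (_ ^+ nat_of_bool _); lia.
by congr (_ * T ^+ _ *+ _); lia.
Qed.

End Reciprocity.

(** * Filters, their zeta matrix and its inverse *)

Section Filters.
Variables (Q : finType) (cov : rel Q).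

Definition is_filter (F : {set Q}) : bool :=
  [forall p, forall q, (p \in F) && cov p q ==> (q \in F)].

Lemma is_filterP (F : {set Q}) :
  reflect (forall p q, p \in F -> cov p q -> q \in F) (is_filter F).
Proof.
apply: (iffP forallP) => [H p q pF pq | H p].
  by move/forallP/(_ q)/implyP: (H p); apply; rewrite pF.
by apply/forallP => q; apply/implyP => /andP[]; apply: H.
Qed.

Lemma is_filter0 : is_filter set0.
Proof. by apply/is_filterP => p q; rewrite inE. Qed.

Lemma is_filterT : is_filter setT.
Proof. by apply/is_filterP => p q _ _; rewrite inE. Qed.

Definition filter_type := {F : {set Q} | F \in is_filter}.

Definition filter_mx (f : {set Q} -> {set Q} -> int) :
    'M[int]_#|{: filter_type}| :=
  \matrix_(i, j) f (val (enum_val i)) (val (enum_val j)).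

Definition filter_entry (F H : {set Q}) (HF : is_filter F) (HH : is_filter H)
    (A : 'M[int]_#|{: filter_type}|) : int :=
  A (enum_rank (Sub F HF : filter_type)) (enum_rank (Sub H HH : filter_type)).

Lemma filter_entry_mx f F H (HF : is_filter F) (HH : is_filter H) :
  filter_entry HF HH (filter_mx f) = f F H.
Proof. by rewrite /filter_entry mxE !enum_rankK. Qed.

Lemma eq_filter_mx f g :
  (forall F H, is_filter F -> is_filter H -> f F H = g F H) ->
  filter_mx f = filter_mx g.
Proof.
move=> fg; apply/matrixP => i j; rewrite !mxE.
by apply: fg; exact: valP.
Qed.

Lemma filter_mx1 : filter_mx (fun F H => (F == H)%:R) = 1.
Proof.
apply/matrixP => i j; rewrite !mxE -(inj_eq enum_val_inj).
by rewrite -(inj_eq val_inj).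
Qed.

Lemma filter_mxM f g :
  filter_mx f * filter_mx g =
  filter_mx (fun F H => \sum_(G | is_filter G) f F G * g G H).
Proof.
apply/matrixP => i j; rewrite !mxE.
under eq_bigr do rewrite !mxE.
rewrite (big_sub is_filter).
rewrite [RHS](reindex (@enum_val _ predT)) //=.
by exists enum_rank => x _; rewrite ?enum_valK ?enum_rankK.
Qed.

Fixpoint walk (f : {set Q} -> {set Q} -> int) (m : nat) (F H : {set Q}) : int :=
  if m is m'.+1 then \sum_(G | is_filter G) walk f m' F G * f G H
  else (F == H)%:R.

Lemma filter_mxX f m : filter_mx f ^+ m = filter_mx (walk f m).
Proof.
elim: m => [|m IH]; first by rewrite expr0 filter_mx1.
by rewrite exprSr IH filter_mxM.
Qed.

(* The steps of the multichains of filters that encode the order-preserving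
   maps, resp. (for [strict]) the strictly order-preserving ones. *)
Definition step (strict : bool) (G H : {set Q}) : bool :=
  (G \subset H) && (strict ==>
    [forall p, forall q, (p \in H) && cov p q ==> (q \in G)]).

Lemma stepP (strict : bool) (G H : {set Q}) : reflect
  (G \subset H /\ (strict -> forall p q, p \in H -> cov p q -> q \in G))
  (step strict G H).
Proof.
apply: (iffP andP) => -[GH K]; split => //.
  move=> s p q pH pq.
  by move/implyP: K => /(_ s)/forallP/(_ p)/forallP/(_ q)/implyP; apply; rewrite pH.
apply/implyP => s; apply/forallP => p; apply/forallP => q; apply/implyP.
by move=> /andP[]; apply: K.
Qed.

Definition stepz (strict : bool) (G H : {set Q}) : int := (step strict G H)%:R.

(** Between filters this is the Moebius function of inclusion, as [zeta_signed_step] shows. The sum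
    of the cardinals has the parity of their difference. *)
Definition signed_step (G H : {set Q}) : int := (-1) ^+ (#|G| + #|H|) * stepz true G H.

(** The sign of each intermediate filter occurs twice along a walk, so only the signs of the two
    ends survive. *)
Lemma walk_signed_step m F H :
  walk signed_step m F H = (-1) ^+ (#|F| + #|H|) * walk (stepz true) m F H.
Proof.
elim: m F H => [|m IH] F H /=.
  case: eqP => [->|_]; last by rewrite mulr0.
  by rewrite addnn -signr_odd odd_double mul1r.
rewrite mulr_sumr; apply: eq_bigr => G _; rewrite IH /signed_step.
rewrite mulrACA -exprD mulrA -[X in X * _ * _]signr_odd.
by rewrite [in RHS]mulrA -[in RHS]signr_odd !oddD addbA addbK.
Qed.

Variables (r : Q -> nat).
Hypothesis r_cov : forall p q, cov p q -> r q = (r p).+1.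

(* Toggling an element of minimal rank in [H :\: F] is a sign-reversing
   involution on the terms of the sum. *)
Lemma signed_step_sum F H : is_filter F -> is_filter H ->
  \sum_(G | is_filter G) stepz false F G * signed_step G H = (F == H)%:R.
Proof.
move=> /is_filterP fF /is_filterP fH.
pose ok (G : {set Q}) := [&& is_filter G, step false F G & step true G H].
have -> : \sum_(G | is_filter G) stepz false F G * signed_step G H =
          \sum_(G | ok G) (-1) ^+ (#|G| + #|H|).
  rewrite [LHS]big_mkcond [RHS]big_mkcond; apply: eq_bigr => G _.
  rewrite /ok /signed_step /stepz.
  by case: is_filter => //; do 2!case: step; rewrite ?mul0r ?mulr0 ?mul1r ?mulr1.
(* That [G] is a filter follows from the last two conditions, so the toggle has to preserve only
   these three. *)
have okP (G : {set Q}) : reflect [/\ F \subset G, G \subset H &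
    forall p q, p \in H -> cov p q -> q \in G] (ok G).
  apply: (iffP and3P) => [[_ /stepP[FG _] /stepP[GH K]] | [FG GH K]].
    by split => //; exact: K.
  split; [apply/is_filterP|apply/stepP|apply/stepP]; try by split.
  by move=> p q pG; apply: K; rewrite (subsetP GH).
case: (eqVneq F H) => [eFH|neFH].
  subst H; rewrite (big_pred1 F) => [|G].
    by rewrite addnn -signr_odd odd_double.
  apply/okP/eqP => [[FG GF _]|->]; last by split.
  by apply/eqP; rewrite eqEsubset GF.
case: (boolP (F \subset H)) => FH; last first.
  rewrite big_pred0 // => G; apply/negP => /okP[FG GH _].
  by case/negP: FH; apply: subset_trans GH.
have [a0 Ha0] : exists a, a \in H :\: F.
  by apply/set0Pn; rewrite setD_eq0; move: neFH; rewrite eqEsubset FH.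
have [a aHF mina] : exists2 a, a \in H :\: F &
    forall p, p \in H :\: F -> (r a <= r p)%N.
  by case: (arg_minnP r Ha0) => a aHF mina; exists a.
have [aF aH] : a \notin F /\ a \in H by apply/andP; rewrite -in_setD.
(* No element of [H] is covered by [a], so removing [a] from [G] keeps the strict condition. *)
have a_min p : p \in H -> cov p a -> false.
  move=> pH pa; have pF : p \notin F by apply: contra aF => /fF; apply.
  by have := mina p; rewrite inE pF pH (r_cov pa) ltnn => /(_ isT).
pose tog (G : {set Q}) := if a \in G then G :\ a else a |: G.
have togK : involutive tog.
  move=> G; rewrite /tog; case: (boolP (a \in G)) => aG.
    by rewrite !inE eqxx /= setD1K.
  by rewrite setU11 setU1K.
have tog_ok (G : {set Q}) : ok G -> ok (tog G).
  move=> /okP[FG GH K]; apply/okP; rewrite /tog; case: ifP => aG; split.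
  - by rewrite subsetD1 FG.
  - by apply: subset_trans GH; rewrite subD1set.
  - move=> p q pH pq; rewrite !inE (K p) // andbT.
    by apply/eqP => qa; have := a_min p pH; rewrite -qa pq => /(_ isT).
  - by apply: subset_trans FG _; rewrite subsetUr.
  - by rewrite subUset sub1set aH.
  - by move=> p q pH pq; rewrite !inE (K p) // orbT.
have tog_sign (G : {set Q}) : (-1) ^+ (#|tog G| + #|H|) = - (-1) ^+ (#|G| + #|H|) :> int.
  rewrite /tog; case: (boolP (a \in G)) => aG.
    by rewrite (cardsD1 a G) aG /= addSn exprS mulN1r opprK.
  by rewrite cardsU1 aG /= addSn exprS mulN1r.
set S := \sum_(G | _) _.
have : S = - S.
  rewrite {1}/S (reindex_inj (inv_inj togK)) /= -sumrN; apply: eq_big => G.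
    apply/idP/idP; last exact: tog_ok.
    by move/tog_ok; rewrite togK.
  by move=> _; rewrite tog_sign.
by rewrite mulr0n; lia.
Qed.

Lemma zeta_signed_step :
  filter_mx (stepz false) * filter_mx signed_step = 1.
Proof.
by rewrite filter_mxM -filter_mx1; apply: eq_filter_mx; exact: signed_step_sum.
Qed.

(** The difference is the matrix of proper inclusion, and the cardinality grows at each proper step,
    so [#|Q| + 1] of them are impossible. *)
Lemma zeta_nilpotent : (filter_mx (stepz false) - 1) ^+ #|Q|.+1 = 0.
Proof.
have -> : filter_mx (stepz false) - 1 = filter_mx (fun F H => (F \proper H)%:R).
  rewrite -filter_mx1; apply/matrixP => i j; rewrite !mxE /stepz /step /= andbT.
  rewrite properEneq; case: eqVneq => [->|_]; first by rewrite subxx subrr.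
  by rewrite subr0.
rewrite filter_mxX; apply/matrixP => i j; rewrite [LHS]mxE [RHS]mxE.
set F := val _; set H := val _.
suff K m (G : {set Q}) : (#|G| < #|F| + m)%N ->
    walk (fun F H => (F \proper H)%:R) m F G = 0.
  by apply: K; rewrite addnS ltnS (leq_trans (max_card (mem H))) ?leq_addl.
elim: m G => [|m IH] G ltGF /=.
  by case: eqP => // eFG; move: ltGF; rewrite eFG addn0 ltnn.
apply: big1 => G' _; case: (boolP (G' \proper G)) => [/proper_card ltG|_].
  by rewrite IH ?mul0r //; lia.
by rewrite mulr0.
Qed.

(** * Order-preserving maps as multichains of filters *)

Section Counting.
Variables (M : nat) (strict : bool).
Implicit Types (f : {ffun Q -> 'I_M.+1}) (G H : {set Q}).

(** The value 0 is exempt from strictness because it stands for lying in no filter of the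
    multichain. *)
Definition compatible f : bool :=
  [forall p, forall q, cov p q ==>
    if strict then (f p == 0 :> nat) || (f p < f q)%N else (f p <= f q)%N].

Lemma compatibleP f : reflect (forall p q, cov p q ->
    if strict then (f p == 0 :> nat) || (f p < f q)%N else (f p <= f q)%N)
  (compatible f).
Proof.
apply: (iffP forallP) => [K p q|K p].
  by move/forallP/(_ q)/implyP: (K p).
by apply/forallP => q; apply/implyP; apply: K.
Qed.

(** The codomain is fixed by [M] while the bound [m] varies, so that an induction on [m] stays in
    one type. The set [H] of nonzero values is the last filter of the multichain. *)
Definition maps_on (m : nat) (H : {set Q}) : {set {ffun Q -> 'I_M.+1}} :=
  [set f | compatible f & [forall p, (f p <= m)%N && ((0 < f p)%N == (p \in H))]].

Lemma maps_onP m H f : reflect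
  [/\ compatible f, forall p, (f p <= m)%N & forall p, (0 < f p)%N = (p \in H)]
  (f \in maps_on m H).
Proof.
rewrite inE; apply: (iffP andP) => [[cf /forallP K]|[cf K1 K2]]; split => //.
- by move=> p; case/andP: (K p).
- by move=> p; case/andP: (K p) => _ /eqP.
- by apply/forallP => p; rewrite K1 K2 eqxx.
Qed.

Definition upper f : {set Q} := [set p | (1 < f p)%N].

Definition raise H f : {ffun Q -> 'I_M.+1} :=
  [ffun p => inord (f p + (p \in H))].

Lemma raiseE m H f p : (m < M)%N -> (f p <= m)%N ->
  raise H f p = (f p + (p \in H))%N :> nat.
Proof. by move=> mM fm; rewrite ffunE inordK //; case: (p \in H); lia. Qed.

Lemma filter_upper m H f : f \in maps_on m H -> is_filter (upper f).
Proof.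
case/maps_onP => /compatibleP cf _ _; apply/is_filterP => p q.
by rewrite !inE => fp /cf; case: strict => /=; lia.
Qed.

(** Removing the last filter [H] of a multichain lowers the map by one on [H]; the previous filter
    is [upper f], and [raise H] undoes the removal. *)
Lemma card_maps_on_fiber m H G : (m < M)%N -> is_filter H ->
  #|[set f in maps_on m.+1 H | upper f == G]| =
  (step strict G H * #|maps_on m G|)%N.
Proof.
move=> mM /is_filterP fH; case: (boolP (step strict G H)) => [/stepP[GH sGH]|nst]; last first.
  rewrite mul0n; apply/eqP; rewrite cards_eq0; apply/eqP/setP => f.
  rewrite [RHS]in_set0 [LHS]in_set.
  apply/negP => /andP[/maps_onP[/compatibleP cf _ fS] /eqP uG].
  case/negP: nst.
  apply/stepP; split.
    by apply/subsetP => p; rewrite -uG -fS inE; lia.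
  by move=> s p q; rewrite -uG -fS inE => fp /cf; rewrite s; lia.
rewrite mul1n -(card_in_imset (f := raise H) (D := maps_on m G)); last first.
  move=> f g /maps_onP[_ fm _] /maps_onP[_ gm _] /ffunP e.
  apply/ffunP => p; apply: val_inj; have /(congr1 val) := e p.
  by rewrite /= (raiseE H mM (fm p)) (raiseE H mM (gm p)) => /addIn.
suff K (f : {ffun Q -> 'I_M.+1}) : f \in maps_on m.+1 H /\ upper f == G <->
    exists2 g : {ffun Q -> 'I_M.+1}, g \in maps_on m G & f = raise H g.
  apply: eq_card => f; rewrite [LHS]in_set.
  by apply/andP/imsetP => /K.
split.
  case=> /maps_onP[/compatibleP cf fm fS] /eqP uG.
  have fG' p : (1 < f p)%N = (p \in G) by rewrite -uG inE.
  pose g : {ffun Q -> 'I_M.+1} := [ffun p => inord (f p).-1].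
  have gE p : g p = (f p).-1 :> nat.
    by rewrite ffunE inordK //; have := fm p; lia.
  exists g; last first.
    apply/ffunP => p; apply: val_inj; rewrite /= (raiseE (m := m) H mM).
      by rewrite gE -fS; lia.
    by rewrite gE; have := fm p; lia.
  apply/maps_onP; split.
  - apply/compatibleP => p q /cf; rewrite !gE; case: strict; lia.
  - by move=> p; rewrite gE; have := fm p; lia.
  - by move=> p; rewrite gE -fG'; lia.
case=> g /maps_onP[/compatibleP cg gm gG] ->{f}.
have rE p := raiseE H mM (gm p).
split.
  apply/maps_onP; split.
  - apply/compatibleP => p q pq; rewrite !rE; move: (cg p q pq) (gG p) (gG q).
    move: (fun pH => fH p q pH pq) (fun s pH => sGH s p q pH pq).
    case: strict; case: (p \in H); case: (q \in H);
      case: (p \in G); case: (q \in G) => //=; lia.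
  - by move=> p; rewrite rE; have := gm p; case: (p \in H); lia.
  - move=> p; rewrite rE; move: (gG p) (subsetP GH p).
    by case: (p \in H); case: (p \in G) => //=; lia.
apply/eqP/setP => p; rewrite inE rE; move: (gG p) (subsetP GH p).
by case: (p \in H); case: (p \in G) => //=; lia.
Qed.

(** A multichain from the empty filter corresponds to the map that sends [p] to the number of
    filters of the multichain that contain [p]. *)
Lemma walk_maps_on m H : (m <= M)%N -> is_filter H ->
  walk (stepz strict) m set0 H = #|maps_on m H|%:R.
Proof.
elim: m H => [|m IH] H mM fH /=.
  pose f0 : {ffun Q -> 'I_M.+1} := [ffun=> ord0].
  have f0_ok : compatible f0.
    by apply/compatibleP => p q _; rewrite !ffunE; case: strict.
  case: eqVneq => [<-|H0].
    suff -> : maps_on 0 set0 = [set f0] by rewrite cards1.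
    apply/setP => f; rewrite [RHS]in_set1; apply/maps_onP/eqP => [[_ fm _]|->].
      by apply/ffunP => p; apply: val_inj; have := fm p; rewrite ffunE /=; lia.
    by split => // p; rewrite ?inE ffunE.
  suff -> : maps_on 0 H = set0 by rewrite cards0.
  apply/setP => f; rewrite [RHS]in_set0; apply/negP => /maps_onP[_ fm fS].
  by move: H0; rewrite eq_sym => /set0Pn[p]; rewrite -fS; have := fm p; lia.
rewrite -sum1_card (partition_big upper is_filter) => [|f]; last first.
  exact: filter_upper.
rewrite natr_sum; apply: eq_bigr => G fG.
rewrite IH ?(ltnW mM) //.
rewrite mulrC /stepz -natrM -(card_maps_on_fiber G mM fH) -sum1_card.
by congr (_%:R); apply: eq_bigl => f; rewrite [LHS]in_set.
Qed.

End Counting.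

(** Ending in the full filter makes all values positive, and subtracting one turns [{1, ..., m+1}]
    into [{0, ..., m}]. *)
Lemma walk_compatible m : walk (stepz false) m.+1 set0 setT =
  #|[set f : {ffun Q -> 'I_m.+1} | compatible false f]|%:R.
Proof.
rewrite (@walk_maps_on m.+1) ?is_filterT //.
pose S (f : {ffun Q -> 'I_m.+1}) : {ffun Q -> 'I_m.+2} :=
  [ffun p => lift ord0 (f p)].
have SE f p : S f p = (f p).+1 :> nat by rewrite ffunE lift0.
rewrite -(card_in_imset (f := S)); last first.
  move=> f g _ _ /ffunP e; apply/ffunP => p; apply: val_inj.
  by have /(congr1 val) := e p; rewrite /= !SE => -[].
congr (_%:R).
suff K (g : {ffun Q -> 'I_m.+2}) : g \in maps_on m.+1 false m.+1 setT <->
    exists2 f : {ffun Q -> 'I_m.+1}, f \in [set f | compatible false f] & g = S f.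
  by apply: eq_card => g; apply/idP/imsetP => /K.
split=> [/maps_onP[/compatibleP cg gm gS]|[f]].
  pose f : {ffun Q -> 'I_m.+1} := [ffun p => inord (g p).-1].
  have fE p : f p = (g p).-1 :> nat.
    by rewrite ffunE inordK //; have := gm p; lia.
  exists f; last first.
    apply/ffunP => p; apply: val_inj; rewrite /= SE fE.
    by have := gS p; rewrite inE; lia.
  rewrite inE; apply/compatibleP => p q /cg; rewrite !fE; lia.
rewrite inE => /compatibleP cf ->; apply/maps_onP; split.
- by apply/compatibleP => p q /cf; rewrite !SE.
- by move=> p; rewrite SE; exact: ltn_ord.
- by move=> p; rewrite SE inE.
Qed.

Lemma walk1 : walk (stepz false) 1 set0 setT = 1.
Proof.
rewrite /= (bigD1 set0) ?is_filter0 //= eqxx mul1r /stepz /step sub0set /=.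
rewrite big1 ?addr0 // => G /andP[_ /negPf G0].
by rewrite eq_sym G0 mul0r.
Qed.

(** * Graded relations and the symmetry of the numerator *)

Variables (l : nat).
Hypothesis r_min : forall q, r q = 1%N \/ exists p, cov p q.
Hypothesis r_max : forall p, r p = l \/ exists q, cov p q.
Hypothesis r_le : forall p, (r p <= l)%N.
Hypothesis l_eq0 : #|Q| = 0%N -> l = 0%N.

Lemma rank_gt0 p : (0 < r p)%N.
Proof. by case: (r_min p) => [->|[q /r_cov ->]]. Qed.

(** Covers lead down to an element of rank 1, where the value is positive, and each of them accounts
    for an increase of at least one. *)
Lemma strict_ge_rank M m (f : {ffun Q -> 'I_M.+1}) p :
  f \in maps_on M true m setT -> (r p <= f p)%N.
Proof.
case/maps_onP => /compatibleP cf _ fS.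
have [k] := ubnP (r p); elim: k p => [|k IH] p; first by lia.
move=> rp; case: (r_min p) => [->|[q qp]]; first by rewrite fS inE.
by move: (cf _ _ qp) (IH q) (fS q) (r_cov qp); rewrite inE; lia.
Qed.

Lemma strict_le_corank M m (f : {ffun Q -> 'I_M.+1}) p :
  f \in maps_on M true m setT -> (f p + l <= m + r p)%N.
Proof.
case/maps_onP => /compatibleP cf fm fS.
have [k] := ubnP (l - r p)%N; elim: k p => [|k IH] p; first by lia.
move=> rp; case: (r_max p) => [->|[q pq]]; first by rewrite leq_add2r fm.
by move: (cf _ _ pq) (IH q) (fS p) (r_cov pq) (r_le q); rewrite inE; lia.
Qed.

(* In a graded relation, [f |-> f - r + 1] turns strictly order-preserving maps
   into order-preserving ones. *)
Lemma card_strict_maps M m : (m < M)%N -> (l <= m)%N ->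
  #|maps_on M true m setT| = #|maps_on M false (m - l).+1 setT|.
Proof.
move=> mM lm.
pose sh (f : {ffun Q -> 'I_M.+1}) : {ffun Q -> 'I_M.+1} :=
  [ffun p => inord (f p - (r p).-1)].
have shE f p : sh f p = (f p - (r p).-1)%N :> nat.
  by rewrite ffunE inordK //; have := ltn_ord (f p); lia.
rewrite -(card_in_imset (f := sh) (D := maps_on M true m setT)); last first.
  move=> f g fm gm /ffunP e; apply/ffunP => p; apply: val_inj.
  have /(congr1 val) := e p; rewrite /= !shE.
  by have := strict_ge_rank p fm; have := strict_ge_rank p gm; lia.
suff K (f : {ffun Q -> 'I_M.+1}) : f \in maps_on M false (m - l).+1 setT <->
    exists2 g : {ffun Q -> 'I_M.+1}, g \in maps_on M true m setT & f = sh g.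
  by apply: eq_card => f; apply/imsetP/idP => /K.
split.
  case/maps_onP => /compatibleP cf fm fS.
  pose g : {ffun Q -> 'I_M.+1} := [ffun p => inord (f p + (r p).-1)].
  have gE p : g p = (f p + (r p).-1)%N :> nat.
    by rewrite ffunE inordK //; have := fm p; have := r_le p; have := rank_gt0 p; lia.
  exists g; last by apply/ffunP => p; apply: val_inj; rewrite /= shE gE addnK.
  apply/maps_onP; split.
  - apply/compatibleP => p q pq; rewrite !gE (r_cov pq).
    by have := cf _ _ pq; have := rank_gt0 p; lia.
  - by move=> p; rewrite gE; have := fm p; have := r_le p; have := rank_gt0 p; lia.
  - by move=> p; rewrite gE; have := fS p; rewrite inE; lia.
case=> g gm ->{f}; have ger p := strict_ge_rank p gm.
have lec p := strict_le_corank p gm.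
case/maps_onP: gm => /compatibleP cg gm gS; apply/maps_onP; split.
- apply/compatibleP => p q pq; rewrite !shE (r_cov pq).
  by move: (cg _ _ pq) (ger p) (ger q) (gS p) (rank_gt0 p); rewrite inE; lia.
- by move=> p; rewrite shE; move: (lec p) (ger p) (rank_gt0 p); lia.
- by move=> p; rewrite shE inE; move: (ger p) (rank_gt0 p); lia.
Qed.

Lemma card_strict_maps0 M m : (m < l)%N -> #|maps_on M true m setT| = 0%N.
Proof.
move=> ml; apply/eqP; rewrite cards_eq0; apply/set0Pn => -[f fm].
(* On the empty set a strict map exists for every [m]; there [l_eq0] gives [l = 0], against
   [m < l]. *)
have [/l_eq0 l0|] := posnP #|Q|; first by lia.
case/card_gt0P => p _.
by move: (strict_ge_rank p fm) (strict_le_corank p fm); lia.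
Qed.

Lemma walk_strict m : walk (stepz true) m set0 setT =
  if (l <= m)%N then walk (stepz false) (m - l).+1 set0 setT else 0.
Proof.
have [lm|ml] := leqP l m.
  rewrite !(@walk_maps_on m.+1) ?is_filterT //; last by lia.
  by rewrite card_strict_maps.
by rewrite (@walk_maps_on m.+1) ?is_filterT // card_strict_maps0.
Qed.

Lemma filter_entry_term (A : 'M[int]_#|{: filter_type}|) i c :
  filter_entry is_filter0 is_filterT ((-1) ^+ i * A *+ c) =
  (-1) ^+ i * c%:R * filter_entry is_filter0 is_filterT A.
Proof.
rewrite /filter_entry mulmxnE -[LHS]mulr_natl -!(signr_odd _ i).
by case: (odd i); rewrite ?expr1 ?expr0 ?mulN1r ?mul1r // mxE mulrN mulNr.
Qed.

Let Z := filter_mx (stepz false).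
Let T := filter_mx signed_step.
(** The coefficient of [t^k] in the numerator of the Ehrhart series, read off as the entry of
    [numer] from the empty to the full filter. *)
Let c k := filter_entry is_filter0 is_filterT (numer Z #|Q| k).

Lemma numer_entryE k : c k = \sum_(0 <= i < k.+1)
  (-1) ^+ i * ('C(#|Q|.+1, i))%:R * walk (stepz false) (k - i).+1 set0 setT.
Proof.
rewrite /c /numer /filter_entry summxE; apply: eq_bigr => i _.
by rewrite -/(filter_entry is_filter0 is_filterT _) filter_entry_term
  /Z filter_mxX filter_entry_mx.
Qed.

(** The sign [(-1)^#|Q|] of [numer_small] cancels against the one that [walk_signed_step] leaves
    between the empty and the full filter. *)
Lemma numer_entry_small k : (k <= #|Q|)%N -> c k =
  \sum_(0 <= i < (#|Q| - k).+1)
    (-1) ^+ i * ('C(#|Q|.+1, i))%:R * walk (stepz true) (#|Q| - k - i) set0 setT.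
Proof.
move=> kN; rewrite /c (numer_small zeta_signed_step zeta_nilpotent kN).
have := filter_entry_term; set S := \sum_(_ <= _ < _) _.
move/(_ S #|Q| 1%N); rewrite mulr1n mulr1 => ->.
rewrite /S /filter_entry summxE mulr_sumr; apply: eq_bigr => i _.
rewrite -/(filter_entry is_filter0 is_filterT _) filter_entry_term.
rewrite filter_mxX filter_entry_mx walk_signed_step cards0 cardsT add0n.
by rewrite mulrCA; congr (_ * _); rewrite mulrA -expr2 sqrr_sign mul1r.
Qed.

Lemma numer_entry0 : c 0 = 1.
Proof.
by rewrite numer_entryE big_nat1 expr0 bin0 subnn !mul1r walk1.
Qed.

(** All strict walks in the sum have fewer than [l] steps, so they contribute 0 by [walk_strict]. *)
Lemma numer_entry_top k : (k <= #|Q|)%N -> (#|Q| < k + l)%N -> c k = 0.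
Proof.
move=> kN kl; rewrite numer_entry_small // big1 // => i _.
by rewrite walk_strict ifF ?mulr0 //; apply/negbTE; lia.
Qed.

(** If [l] exceeded [#|Q|], then [numer_entry_top] would give [c 0 = 0], against [numer_entry0]. *)
Lemma rank_le_card : (l <= #|Q|)%N.
Proof.
rewrite leqNgt; apply/negP => ltl.
by have := numer_entry0; rewrite numer_entry_top.
Qed.

Lemma numer_entry_sym k : (k <= #|Q| - l)%N -> c k = c (#|Q| - l - k)%N.
Proof.
move=> kl; have lN := rank_le_card.
rewrite numer_entry_small; last by lia.
(* The terms with [i > #|Q| - l - k] involve strict walks of fewer than [l] steps; by [walk_strict]
   the others are the terms of [c (#|Q| - l - k)]. *)
rewrite numer_entryE (@big_cat_nat _ _ _ (#|Q| - l - k).+1) //=; last by lia.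
rewrite [X in _ + X]big_nat_cond [X in _ + X]big1 => [|i]; last first.
  move=> /andP[/andP[li iN] _].
  by rewrite walk_strict ifF ?mulr0 //; apply/negbTE; lia.
rewrite addr0 [LHS]big_nat_cond [RHS]big_nat_cond.
apply: eq_bigr => i /andP[/andP[_ ik] _].
rewrite walk_strict ifT; last by move: (#|Q|) kl lN ik => N; lia.
by congr (_ * walk _ _.+1 _ _); move: (#|Q|) kl lN ik => N; lia.
Qed.

Theorem graded_hstar_palindromic (e : nat -> int) :
  (forall m, e m = walk (stepz false) m.+1 set0 setT) ->
  exists h : {poly int},
    (forall k, ((1 - 'X) ^+ #|Q|.+1 * \poly_(m < k.+1) e m)`_k = h`_k)
    /\ palindromic h.
Proof.
move=> eE; exists (\poly_(k < (#|Q| - l).+1) c k).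
have lN := rank_le_card.
(* The leading coefficient is [c (#|Q| - l) = c 0 = 1], so the degree is exactly the centre of the
   symmetry doubled. *)
have szh : size (\poly_(k < (#|Q| - l).+1) c k) = (#|Q| - l).+1.
  apply: size_poly_eq; rewrite numer_entry_sym // subnn.
  by rewrite numer_entry0.
split => [k|i]; last first.
  by rewrite szh /= => il; rewrite !coef_poly !ltnS leq_subr il numer_entry_sym.
rewrite coef_exp1subX_poly coef_poly.
transitivity (c k).
  by rewrite numer_entryE big_mkord; apply: eq_bigr => i _; rewrite eE.
case: ltnP => // kl; have [kN|kN] := leqP k #|Q|.
  by apply: numer_entry_top; lia.
rewrite /c (numer_large zeta_nilpotent kN) //.
by rewrite /filter_entry mxE.
Qed.

End Filters.

(** * Order polytopes *)

Section ConvHull.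
Local Open Scope classical_set_scope.
Variables (R : realType) (V : lmodType R).
Implicit Type X : set V.

Lemma conv_hull_gen X x : X x -> conv_hull X x.
Proof. exact: sub_gen_smallest. Qed.

Lemma conv_hull_convex X (x y : V) (t : R) : conv_hull X x -> conv_hull X y ->
  0 <= t -> t <= 1 -> conv_hull X (t *: x + (1 - t) *: y).
Proof.
move=> Xx Xy t0 t1 A [Aconv XA].
have Ax : A x by exact: Xx.
have Ay : A y by exact: Xy.
have := Aconv x y (Itv01 t0 t1); rewrite !in_setE.
by apply.
Qed.

Lemma conv_hull_sub X (A : set V) :
  (forall x y t, A x -> A y -> 0 <= t -> t <= 1 -> A (t *: x + (1 - t) *: y)) ->
  (forall x, X x -> A x) -> forall x, conv_hull X x -> A x.
Proof.
move=> Aconv XA; apply: smallest_sub => // x y t; rewrite !in_setE => Ax Ay.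
exact: Aconv.
Qed.

(** The point [y] is the average, built up by giving the average of the first points the weight
    [t = (m + 1) / (m + 2)]. This puts a sum of [m + 1] vertices into the dilate by [m + 1]. *)
Lemma conv_hull_sum X (m : nat) (x : nat -> V) :
  (forall i, (i <= m)%N -> X (x i)) ->
  exists2 y, conv_hull X y & \sum_(i < m.+1) x i = m.+1%:R *: y.
Proof.
elim: m => [|m IH] Xx.
  by exists (x 0%N); [apply: conv_hull_gen; exact: Xx|rewrite big_ord1 scale1r].
have [i im|y Xy Ey] := IH; first by apply: Xx; rewrite leqW.
pose t : R := m.+1%:R / m.+2%:R.
have m2 : (m.+2%:R : R) != 0 by rewrite pnatr_eq0.
exists (t *: y + (1 - t) *: x m.+1).
  apply: conv_hull_convex => //.
  - by apply: conv_hull_gen; exact: Xx.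
  - by rewrite divr_ge0.
  - by rewrite ler_pdivrMr ?ltr0n // mul1r ler_nat.
rewrite big_ord_recr /= Ey scalerDr !scalerA; congr (_ + _).
  by congr (_ *: _); rewrite /t mulrC divfK.
rewrite -[LHS]scale1r; congr (_ *: _).
rewrite /t mulrBr mulr1 mulrC divfK // -natr1 addrAC subrr add0r //.
Qed.

End ConvHull.

(** * Polytopes whose vertices are indexed by filters *)

Section OrderPolytope.
Local Open Scope classical_set_scope.
Variables (R : realType) (n : nat) (Q : finType) (cov : rel Q) (r : Q -> nat).
Variable l : nat.
Hypothesis r_cov : forall p q, cov p q -> r q = (r p).+1.
Hypothesis r_min : forall q, r q = 1%N \/ exists p, cov p q.
Hypothesis r_max : forall p, r p = l \/ exists q, cov p q.
Hypothesis r_le : forall p, (r p <= l)%N.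
Hypothesis l_eq0 : #|Q| = 0%N -> l = 0%N.

(** A homogenised affine map: the first argument is the dilation factor, so [Phi m] describes the
    [m]-th dilate of the polytope. The two integrality hypotheses make it unimodular. *)
Variable Phi : R -> (Q -> R) -> 'M[R]_n.
Hypothesis Phi_linear : forall a m y m' y',
  Phi (a * m + m') (fun q => a * y q + y' q) = a *: Phi m y + Phi m' y'.
Hypothesis Phi_int : forall m y, m \is a Num.int ->
  (forall q, y q \is a Num.int) -> forall i j, Phi m y i j \is a Num.int.
Hypothesis Phi_int_inv : forall m y, m \is a Num.int ->
  (forall i j, Phi m y i j \is a Num.int) -> forall q, y q \is a Num.int.

Definition indic (F : {set Q}) (q : Q) : R := (q \in F)%:R.

Variable X : {set 'S_n}.
Hypothesis X_filter : forall s, s \in X ->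
  exists2 F, is_filter cov F & perm_mx s = Phi 1 (indic F).
Hypothesis filter_X : forall F, is_filter cov F ->
  exists2 s, s \in X & perm_mx s = Phi 1 (indic F).

Let P := perm_polytope R n X.

Lemma Phi_comb a m y b m' y' : Phi (a * m + b * m') (fun q => a * y q + b * y' q) =
  a *: Phi m y + b *: Phi m' y'.
Proof.
have P0 : Phi 0 (fun=> 0) = 0.
  have := Phi_linear (- 1) 0 (fun=> 0) 0 (fun=> 0).
  by rewrite !mulr0 addr0 scaleN1r addNr.
have -> : b * m' = b * m' + 0 by rewrite addr0.
have -> : (fun q => a * y q + b * y' q) = (fun q => a * y q + (b * y' q + 0)).
  by apply/funext => q; rewrite addr0.
by rewrite (Phi_linear _ _ _ _ (fun q => b * y' q + 0)) Phi_linear P0 addr0.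
Qed.

Lemma PhiZ a m y : Phi (a * m) (fun q => a * y q) = a *: Phi m y.
Proof.
rewrite -[RHS]addr0 -(scale0r (Phi m y)) -Phi_comb mul0r addr0.
by congr (Phi _ _); apply/funext => q; rewrite mul0r addr0.
Qed.

Lemma PhiD m y m' y' : Phi (m + m') (fun q => y q + y' q) = Phi m y + Phi m' y'.
Proof.
rewrite -[Phi m y]scale1r -[Phi m' y']scale1r -Phi_comb !mul1r.
by congr (Phi _ _); apply/funext => q; rewrite !mul1r.
Qed.

Lemma Phi00 : Phi 0 (fun=> 0) = 0.
Proof.
have := PhiZ 0 0 (fun=> 0); rewrite mul0r scale0r => <-.
by congr (Phi _ _); apply/funext => q; rewrite mul0r.
Qed.

Lemma Phi_sum (I : Type) (s : seq I) (m : I -> R) (y : I -> Q -> R) :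
  Phi (\sum_(i <- s) m i) (fun q => \sum_(i <- s) y i q) =
  \sum_(i <- s) Phi (m i) (y i).
Proof.
elim: s => [|i s IH].
  rewrite !big_nil -Phi00; congr (Phi _ _).
  by apply/funext => q; rewrite big_nil.
rewrite !big_cons -IH -PhiD; congr (Phi _ _).
by apply/funext => q; rewrite big_cons.
Qed.

(* A kernel vector rescaled to have an entry [1/2] would contradict integrality. *)
Lemma Phi0_inj y : Phi 0 y = 0 -> forall q, y q = 0.
Proof.
move=> y0 q; apply/eqP; apply: contraT => yq.
have E : Phi 0 (fun p => (2 * y q)^-1 * y p) = 0.
  by rewrite -[0 in LHS](mulr0 (2 * y q)^-1) PhiZ y0 scaler0.
have half : (2 * y q)^-1 * y q \is a Num.int.
  apply: (Phi_int_inv (m := 0) (y := fun p => (2 * y q)^-1 * y p)) => // i j.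
  by rewrite E mxE.
have {half} : 2^-1 \is a @Num.int R.
  by move: half; rewrite invfM -mulrA mulVf ?mulr1.
case/intrP => z; move/(congr1 (fun x => 2 * x)).
rewrite divff ?pnatr_eq0 // => /eqP.
by rewrite -[1]/(1%:~R) -[2]/(2%:~R) -intrM eqr_int; lia.
Qed.

Lemma Phi_inj m y y' : Phi m y = Phi m y' -> y =1 y'.
Proof.
move=> e q; apply/eqP; rewrite -subr_eq0; apply/eqP.
apply: (@Phi0_inj (fun q => y q - y' q)) => //.
have := Phi_comb 1 m y (- 1) m y'; rewrite mul1r mulN1r subrr e.
rewrite scale1r scaleN1r subrr => <-; congr (Phi _ _).
by apply/funext => p; rewrite mul1r mulN1r.
Qed.

Lemma polytope_filter F : is_filter cov F -> P (Phi 1 (indic F)).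
Proof.
by case/filter_X => s sX <-; apply: conv_hull_gen; exists s.
Qed.

(** Order-preserving maps into [[0, 1]] form a convex set that contains the indicators of filters. A
    converse for lattice points of dilates is part of [lattice_ptP]. *)
Lemma polytope_sub x : P x -> exists y : Q -> R,
  [/\ forall q, 0 <= y q, forall q, y q <= 1,
      forall p q, cov p q -> y p <= y q & x = Phi 1 y].
Proof.
move: x; apply: conv_hull_sub => [x x' t|x [s sX <-]].
  case=> y [y0 y1 ym ->] [y' [y'0 y'1 y'm ->]] t0 t1.
  have t1' : 0 <= 1 - t by rewrite subr_ge0.
  exists (fun q => t * y q + (1 - t) * y' q); split.
  - by move=> q; rewrite addr_ge0 // mulr_ge0.
  - move=> q; rewrite -[leRHS](subrK t) addrC.
    by rewrite lerD // ler_piMr.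
  - by move=> p q pq; rewrite lerD // ler_wpM2l // ?ym ?y'm.
  - rewrite -Phi_comb; congr (Phi _ _); ring.
case: (X_filter sX) => F /is_filterP fF' ->; exists (indic F); split => //.
- by move=> q; rewrite /indic; case: (q \in F).
- move=> p q pq; rewrite /indic ler_nat.
  by case: (boolP (p \in F)) => // pF; rewrite (fF' _ _ pF pq).
Qed.

Definition up_closure (q : Q) : {set Q} := [set p | connect cov q p]%SET.

Lemma is_filter_up_closure q : is_filter cov (up_closure q).
Proof.
apply/is_filterP => p p'; rewrite !inE => qp pp'.
exact: connect_trans qp (connect1 pp').
Qed.

Lemma connect_rank q p : connect cov q p -> q = p \/ (r q < r p)%N.
Proof.
case/connectP => s; elim: s q => [|x s IH] q /=; first by move=> _ ->; left.
move=> /andP[qx xs] ps; right.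
by case: (IH x xs ps) => [<-|]; rewrite ?(r_cov qx) //; lia.
Qed.

(** The indicators of principal filters are triangular for the rank: at [q], only [q] and elements
    of smaller rank contribute. *)
Lemma up_closure_free (c : Q -> R) :
  (forall p, \sum_q c q * indic (up_closure q) p = 0) -> forall q, c q = 0.
Proof.
move=> H q; have [k] := ubnP (r q); elim: k q => [//|k IH] q rq.
have := H q; rewrite (bigD1 q) //= /indic inE connect0 mulr1 big1 ?addr0 //.
move=> p pq; rewrite inE; case: (boolP (connect cov p q)) => [cpq|_].
  rewrite IH ?mul0r //; case: (connect_rank cpq) => [epq|]; last by lia.
  by rewrite epq eqxx in pq.
by rewrite mulr0.
Qed.

Lemma affine_dim_polytope : affine_dim P = #|Q|.
Proof.
apply/eqP; rewrite eqn_leq; apply/andP; split.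
  apply/bigmax_leqP => k /asboolP[x0 [Y [Px0 PY freeY]]].
  rewrite -(size_tuple Y) -(eqP freeY).
  (* Differences of points of [P] lie in the span of these [#|Q|] vectors. *)
  pose d q : 'M[R]_n := Phi 0 (fun p => (p == q)%:R).
  have : (<<Y>> <= <<[seq d q | q : Q]>>)%VS.
    apply/span_subvP => x /PY.
    case: (polytope_sub Px0) => y0 [_ _ _ ->].
    case/polytope_sub => y1 [_ _ _].
    move/(canRL (addKr _)) => ->.
    have -> : - Phi 1 y0 + Phi 1 y1 = \sum_q (y1 q - y0 q) *: d q.
      rewrite -scaleN1r -[Phi 1 y1]scale1r -Phi_comb mulN1r mulr1 addNr.
      under [RHS]eq_bigr do rewrite -PhiZ mulr0.
      rewrite -Phi_sum big1 //; congr (Phi _ _); apply/funext => p.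
      rewrite (bigD1 p) //= eqxx big1 ?addr0 => [|q /negPf qp].
        by rewrite mulN1r mul1r mulr1 addrC.
      by rewrite eq_sym qp mulr0.
    apply: memv_suml => q _; apply: memvZ; apply: memv_span.
    by apply/mapP; exists q => //; rewrite mem_enum.
  move/dimvS/leq_trans; apply; apply: leq_trans (dim_span _) _.
  by rewrite size_map -cardE.
(* Conversely, these are the directions from the vertex of the empty filter to the vertices of the
   principal filters. *)
pose Y := map_tuple (fun q => Phi 0 (indic (up_closure q))) (enum_tuple Q).
have freeY : free Y.
  apply/freeP => k.
  under eq_bigr => i _ do rewrite (nth_map (enum_val i)) -?cardE ?ltn_ord //
    -enum_val_nth -PhiZ mulr0.
  rewrite -Phi_sum big1 // => /Phi0_inj H.
  pose c q := k (enum_rank q).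
  have c0 : forall q, c q = 0.
    apply: up_closure_free => p; rewrite -[RHS](H p).
    rewrite (reindex (@enum_val _ predT)) /=; last first.
      by exists enum_rank => x _; rewrite ?enum_valK ?enum_rankK.
    by apply: eq_bigr => i _; rewrite /c enum_valK.
  by move=> i; rewrite -(c0 (enum_val i)) /c enum_valK.
have ltd : (#|Q| < (\dim {:'M[R]_n}).+1)%N.
  by rewrite ltnS -[X in (X <= _)%N](size_tuple Y) -(eqP freeY) dimvS ?subvf.
apply: (@leq_bigmax_cond _ _ _ (Ordinal ltd)); apply/asboolP.
exists (Phi 1 (indic finset.set0)), Y; split => //.
  by apply: polytope_filter; exact: is_filter0.
move=> x /mapP[q _ ->]; rewrite -PhiD addr0.
have -> : (fun p => indic finset.set0 p + indic (up_closure q) p) =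
    indic (up_closure q).
  by apply/funext => p; rewrite /indic inE add0r.
by apply: polytope_filter; exact: is_filter_up_closure.
Qed.

Definition lattice_pt m (f : {ffun Q -> 'I_m.+1}) : 'M[int]_n :=
  map_mx Num.floor (Phi m%:R (fun q => (f q)%:R)).

Lemma lattice_ptK m (f : {ffun Q -> 'I_m.+1}) :
  map_mx intr (lattice_pt f) = Phi m%:R (fun q => (f q)%:R).
Proof.
apply/matrixP => i j; rewrite !mxE floorK //.
by apply: Phi_int => [|q]; apply: rpred_nat.
Qed.

Lemma lattice_ptP m (A : 'M[int]_n) :
  [set m.+1%:R *: x | x in P] (map_mx intr A) <->
  exists2 f : {ffun Q -> 'I_m.+2}, compatible cov false f & A = lattice_pt f.
Proof.
split.
  case=> _ /polytope_sub[y [y0 y1 ym ->]].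
  rewrite -PhiZ mulr1 => E.
  have yint q : m.+1%:R * y q \is a Num.int.
    apply: (Phi_int_inv (m := m.+1%:R) (y := fun q => m.+1%:R * y q)).
      exact: rpred_nat.
    by move=> i j; rewrite E mxE; apply: rpred_int.
  pose f : {ffun Q -> 'I_m.+2} :=
    [ffun q => inord `|Num.floor (m.+1%:R * y q)|%N].
  have fE q : (f q)%:R = m.+1%:R * y q.
    have fge0 : 0 <= Num.floor (m.+1%:R * y q).
      by rewrite floor_ge0 mulr_ge0.
    rewrite ffunE inordK.
      by rewrite natr_absz ger0_norm // floorK.
    rewrite ltnS -(ler_nat R) natr_absz ger0_norm // floorK //.
    by rewrite ler_piMr.
  have fE' : (fun q => (f q)%:R) = (fun q => m.+1%:R * y q).
    by apply/funext => q; exact: fE.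
  exists f.
    apply/compatibleP => p q pq.
    by rewrite -(ler_nat R) !fE ler_wpM2l // ym.
  have := lattice_ptK f; rewrite fE' E => /matrixP H; apply/matrixP => i j.
  by have := H i j; rewrite !mxE => /intr_inj.
case=> f /compatibleP cf ->; rewrite lattice_ptK.
(* The map [f] is the sum of the indicators of its level filters [F 0, ..., F m], so the matrix is a
   sum of [m + 1] vertices. *)
pose F t : {set Q} := [set q | (t < f q)%N]%SET.
have fF t : is_filter cov (F t).
  by apply/is_filterP => p q; rewrite !inE => tp /cf /(leq_trans tp).
have [t _|x Px E] := @conv_hull_sum R _ [set (perm_mx s : 'M[R]_n) | s in [set` X]] m
    (fun t => Phi 1 (indic (F t))).
  by have [s sX <-] := filter_X (fF t); exists s.
exists x => //; rewrite -E -Phi_sum; congr (Phi _ _).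
  by rewrite sumr_const card_ord.
apply/funext => q; rewrite /indic -natr_sum; congr (_%:R).
have fm : (f q <= m.+1)%N by rewrite -ltnS.
rewrite -[RHS]card_ord -sum1_card (big_ord_widen m.+1 (fun=> 1%N)); last exact: fm.
by rewrite [RHS]big_mkcond; apply: eq_bigr => i _; rewrite inE; case: ltnP.
Qed.

Lemma lattice_points_polytope m : lattice_points P m.+1 =
  #|[set f : {ffun Q -> 'I_m.+2} | compatible cov false f]%SET|.
Proof.
pose s := [seq lattice_pt f | f in
  [set f : {ffun Q -> 'I_m.+2} | compatible cov false f]%SET].
rewrite /lattice_points.
have -> : [set A : 'M[int]_n | [set m.+1%:R *: x | x in P] (map_mx intr A)] =
    [set` [fset A in s]%fset].
  apply/seteqP; split => A /=; rewrite in_fset /=.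
    move/lattice_ptP => [f cf ->]; apply/fintype.imageP; exists f => //.
    by rewrite inE.
  by case/fintype.imageP => f; rewrite inE => cf ->; apply/lattice_ptP; exists f.
rewrite set_fsetK card_fseq undup_id ?size_map -?cardE //.
rewrite map_inj_in_uniq ?enum_uniq // => f g _ _.
move/(congr1 (map_mx (intr : int -> R))); rewrite !lattice_ptK => /Phi_inj H.
by apply/ffunP => q; apply: val_inj; apply/eqP; rewrite -(eqr_nat R) H.
Qed.

Theorem order_polytope_palindromic : has_palindromic_hstar P.
Proof.
have [|h [hE hP]] := graded_hstar_palindromic r_cov r_min r_max r_le l_eq0
  (e := ehrhart_coef P).
  case=> [|m]; first by rewrite walk1.
  by rewrite walk_compatible -lattice_points_polytope natz.
by exists h; split => // k; rewrite affine_dim_polytope.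
Qed.

End OrderPolytope.

(** * Filters of cells and lattice paths *)

Lemma initial_segment (P : nat -> bool) (N : nat) :
  (forall k, P k.+2 -> P k.+1) -> (forall k, (N < k)%N -> ~~ P k) ->
  exists2 g, (g <= N)%N & forall k, (0 < k)%N -> P k = (k <= g)%N.
Proof.
move=> Pdown; elim: N => [|N IH] PN.
  by exists 0%N => // -[|k] // _; apply/negbTE/PN.
case: (boolP (P N.+1)) => PN1.
  exists N.+1 => // k k0; case: leqP => [|/PN/negbTE->//].
  have Pd d i : P (i.+1 + d)%N -> P i.+1.
    by elim: d => [|d IHd]; rewrite ?addn0 // addnS => /Pdown.
  by move=> kN; have := Pd (N.+1 - k)%N k.-1; rewrite prednK // subnKC // => ->.
have [k|g gN Pg] := IH; last by exists g => //; exact: leqW.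
by case: (ltngtP k N.+1) => [|/PN//|->//]; lia.
Qed.

Section Cells.
Variables (n T : nat) (lo hi : nat -> nat).

(** The bounds [lo] and [hi] are the lowest and the highest path, and cells are the points where
    paths can differ. At times from [n] to [T] the bounds agree by [lo_hi_n], so [t < n] loses no
    cell. *)
Definition in_diagram (t k : nat) : bool := [&& lo t < k, k <= hi t & t < n]%N.

Definition cell := {p : 'I_n * 'I_n | in_diagram p.1 p.2}.

Definition crow (q : cell) : nat := (val q).1.
Definition ccol (q : cell) : nat := (val q).2.

(** A path [g] corresponds to the filter of the cells with [k <= g t]. The first kind of cover says
    that [g] never decreases, the second that its steps are at most 1. *)
Definition cell_cov (p q : cell) : bool :=
  ((crow q == (crow p).+1) && (ccol q == ccol p)) ||
  ((crow p == (crow q).+1) && (ccol p == (ccol q).+1)).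

Hypothesis hi_ltn : forall t, (t < n)%N -> (hi t < n)%N.
Hypothesis n_le : (n <= T.+1)%N.
Hypothesis lo_hi_n : forall t, (t <= T)%N -> (n <= t)%N -> lo t = hi t.

Lemma cellP (q : cell) : in_diagram (crow q) (ccol q).
Proof. exact: (valP q). Qed.

Lemma cell_exists t k : in_diagram t k ->
  exists q : cell, crow q = t /\ ccol q = k.
Proof.
move=> D; have tn : (t < n)%N by case/and3P: D.
have kn : (k < n)%N by case/and3P: D => _ /leq_ltn_trans + _; apply; exact: hi_ltn.
by exists (Sub (Ordinal tn, Ordinal kn) (D : in_diagram (Ordinal tn) (Ordinal kn))).
Qed.

Lemma cell_inj (p q : cell) : crow p = crow q -> ccol p = ccol q -> p = q.
Proof.
move=> e1 e2; apply: val_inj; case: p q e1 e2 => -[a b] D [[c d] D'] /=.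
by rewrite /crow /ccol /= => e1 e2; congr (_, _); apply: val_inj.
Qed.

Section Ext.
Variable R : realType.

(* The value of [y] at the cell [(t, k)], extended by the constant [m] below the
   diagram and by [0] above it. *)
Definition ext (m : R) (y : cell -> R) (t k : nat) : R :=
  if [pick q : cell | (crow q == t) && (ccol q == k)] is Some q then y q
  else if (k <= lo t)%N then m else 0.

Lemma ext_cell m y q : ext m y (crow q) (ccol q) = y q.
Proof.
rewrite /ext; case: pickP => [p /andP[/eqP e1 /eqP e2]|/(_ q)].
  by rewrite (cell_inj e1 e2).
by rewrite !eqxx.
Qed.

Lemma ext_out m y t k : ~~ in_diagram t k ->
  ext m y t k = if (k <= lo t)%N then m else 0.
Proof.
move=> D; rewrite /ext; case: pickP => // q /andP[/eqP e1 /eqP e2].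
by move: D; rewrite -e1 -e2 cellP.
Qed.

Lemma ext_linear a m y m' y' t k :
  ext (a * m + m') (fun q => a * y q + y' q) t k =
  a * ext m y t k + ext m' y' t k.
Proof.
rewrite /ext; case: pickP => // _; case: ifP => // _.
by rewrite mulr0 addr0.
Qed.

Lemma ext_int m y t k : m \is a Num.int -> (forall q, y q \is a Num.int) ->
  ext m y t k \is a Num.int.
Proof.
by move=> mint yint; rewrite /ext; case: pickP => // _; case: ifP => // _; apply: rpred0.
Qed.

Definition is_path (g : nat -> nat) : Prop :=
  (forall t, (t <= T)%N -> (lo t <= g t <= hi t)%N) /\
  (forall t, (t < T)%N -> (g t <= g t.+1 <= (g t).+1)%N).

Definition path_of (F : {set cell}) (g : nat -> nat) : Prop :=
  forall t k, (t <= T)%N -> ext 1 (@indic R cell F) t k = (k <= g t)%N%:R.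

Lemma filter_of_path g : is_path g ->
  exists2 F, is_filter cell_cov F & path_of F g.
Proof.
case=> gb gs; exists [set q | ccol q <= g (crow q)]%N%SET.
  apply/is_filterP => p q; rewrite !inE => pg.
  have := cellP p; have := cellP q; rewrite /in_diagram.
  move=> /and3P[_ _ qn] /and3P[_ _ pn].
  case/orP => /andP[/eqP e1 /eqP e2].
    by have := gs (crow p); rewrite -e1 e2; lia.
  by have := gs (crow q); rewrite -e1; lia.
move=> t k tT; case: (boolP (in_diagram t k)) => [/cell_exists[q [<- <-]]|D].
  by rewrite ext_cell /indic inE.
rewrite ext_out //; have := gb t tT; have := lo_hi_n tT.
move=> H gl; have -> : (k <= g t)%N = (k <= lo t)%N.
  by move: D; rewrite /in_diagram; lia.
by case: ifP.
Qed.

Hypothesis lo_hi_0 : lo 0 = 0%N /\ hi 0 = 0%N.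
Hypothesis lo_step : forall t, (lo t <= lo t.+1 <= (lo t).+1)%N.
Hypothesis hi_step : forall t, (hi t <= hi t.+1 <= (hi t).+1)%N.
Hypothesis lo_hi : forall t, (t <= T)%N -> (lo t <= hi t)%N.

Lemma path_of_filter F : is_filter cell_cov F ->
  exists2 g, is_path g & path_of F g.
Proof.
move/is_filterP => fF.
pose e t k := ext 1 (@indic R cell F) t k == 1.
have eE t k : ext 1 (@indic R cell F) t k = (e t k)%:R.
  rewrite /e /ext /indic; case: pickP => [q _|_]; first case: (q \in F).
  - by rewrite eqxx.
  - by rewrite eq_sym oner_eq0.
  - by case: ifP => _; rewrite ?eqxx // eq_sym oner_eq0.
have bR (a b : bool) : a%:R = b%:R :> R -> a = b.
  by move/eqP; rewrite eqr_nat; case: a; case: b.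
have e_cell q : e (crow q) (ccol q) = (q \in F).
  by apply: bR; rewrite -eE ext_cell.
have e_out t k : ~~ in_diagram t k -> e t k = (k <= lo t)%N.
  move=> D; apply: bR; rewrite -eE ext_out //.
  by case: ifP.
(* Inside the diagram this is a cover of the first kind; if a point lies outside, the steps of the
   bounds give it. The next claim treats the second kind. *)
have e_up t k : (t < T)%N -> e t k -> e t.+1 k.
  move=> tT; have := lo_step t; have := hi_step t; have := lo_hi tT.
  have := lo_hi_n tT; have := lo_hi (ltnW tT).
  case: (boolP (in_diagram t k)) => D; case: (boolP (in_diagram t.+1 k)) => D'.
  - move=> _ _ _ _ _; have [p [p1 p2]] := cell_exists D.
    have [q [q1 q2]] := cell_exists D'.
    rewrite -{1}p1 -{1}p2 -q1 -q2 !e_cell => /fF; apply.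
    by rewrite /cell_cov p1 p2 q1 q2 !eqxx.
  - by rewrite [e t.+1 k]e_out //; move: D D'; rewrite /in_diagram; lia.
  - by rewrite [e t k]e_out //; move: D D'; rewrite /in_diagram; lia.
  - by rewrite !e_out //; lia.
have e_down t k : (t < T)%N -> e t.+1 k.+1 -> e t k.
  move=> tT; have := lo_step t; have := hi_step t; have := lo_hi tT.
  have := lo_hi_n tT; have := lo_hi (ltnW tT).
  case: (boolP (in_diagram t k)) => D; case: (boolP (in_diagram t.+1 k.+1)) => D'.
  - move=> _ _ _ _ _; have [p [p1 p2]] := cell_exists D.
    have [q [q1 q2]] := cell_exists D'.
    have -> : e t k = (p \in F) by rewrite -p1 -p2 e_cell.
    have -> : e t.+1 k.+1 = (q \in F) by rewrite -q1 -q2 e_cell.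
    move/fF; apply.
    by rewrite /cell_cov p1 p2 q1 q2 !eqxx orbT.
  - by rewrite [e t.+1 _]e_out //; move: D D'; rewrite /in_diagram; lia.
  - rewrite [e t k]e_out //; move: D D'; rewrite /in_diagram; lia.
  - by rewrite !e_out //; lia.
(* A round trip through a neighbouring time, [t + 1] or [T - 1], lowers the height by one. For
   [T = 0] there is no neighbour, but both bounds vanish at time 0. *)
have e_anti t k : (t <= T)%N -> e t k.+1 -> e t k.
  case: (ltngtP t T) => // [tT _ /(e_up _ _ tT)|-> _]; first exact: e_down.
  case: T e_up e_down => [|T'] e_up' e_down'; last by move/e_down'/e_up'; apply.
  by case: lo_hi_0 => l0 h0; rewrite e_out /in_diagram ?l0 ?h0; lia.
have seg t : exists g, (t <= T)%N -> forall k, e t k = (k <= g)%N.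
  case: (leqP t T) => tT; last by exists 0%N.
  have [k|k hk|g _ gP] := @initial_segment (e t) (hi t).
  - exact: e_anti.
  - by rewrite e_out; have := lo_hi tT; rewrite ?/in_diagram; lia.
  exists g => _ [|k]; last exact: gP.
  by rewrite e_out // /in_diagram.
have [g gP'] := choice seg.
have gP t k : (t <= T)%N -> e t k = (k <= g t)%N by move=> tT; exact: gP'.
exists g; last by move=> t k tT; rewrite eE gP.
split=> t tT.
  apply/andP; split; first by rewrite -gP // e_out // /in_diagram; lia.
  rewrite leqNgt -gP // e_out; have := lo_hi tT; rewrite ?/in_diagram; lia.
apply/andP; split; first by rewrite -gP // e_up // gP // ltnW.
case: (ltnP (g t).+1 (g t.+1)) => //; rewrite -gP // => /e_down.
by move/(_ tT); rewrite gP ?ltnn // ltnW.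
Qed.

End Ext.
End Cells.

(** * Permutations avoiding 132 and 312 *)

Lemma perm_neq n (s : 'S_n) (i j : 'I_n) : (i < j)%N -> s i != s j :> nat.
Proof.
by move=> ij; rewrite (inj_eq val_inj) (inj_eq perm_inj) -(inj_eq val_inj) ltn_eqF.
Qed.

Lemma contains_pattern3 n (s : 'S_n) x y z : uniq [:: x; y; z] ->
  reflect (exists a b c : 'I_n, [/\ (a < b < c)%N,
      (s a < s b)%N = (x < y)%N, (s a < s c)%N = (x < z)%N
      & (s b < s c)%N = (y < z)%N])
    (contains_pattern s [:: x; y; z]).
Proof.
rewrite /= !inE andbT negb_or -andbA => /and3P[xy xz yz].
apply: (iffP existsP) => [[f fP]|[a [b [c [abc ab ac bc]]]]].
  have K i j := forallP (forallP fP i) j.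
  pose o (k : nat) (k3 : (k < 3)%N) := Ordinal k3 : 'I_(size [:: x; y; z]).
  exists (f (o 0%N isT)), (f (o 1%N isT)), (f (o 2%N isT)).
  have /andP[/= l01 /eqP/= e01] := K (o 0%N isT) (o 1%N isT).
  have /andP[/= l02 /eqP/= e02] := K (o 0%N isT) (o 2%N isT).
  have /andP[/= l12 /eqP/= e12] := K (o 1%N isT) (o 2%N isT).
  by rewrite l01 l12; split.
case/andP: abc => a_b b_c.
have n_ab := negbTE (perm_neq s a_b); have n_bc := negbTE (perm_neq s b_c).
have n_ac := negbTE (perm_neq s (ltn_trans a_b b_c)).
exists [ffun i : 'I_(size [:: x; y; z]) => nth a [:: a; b; c] i].
apply/forallP => i; apply/forallP => j; rewrite !ffunE.
move: i j => [[|[|[|i]]] i3] [[|[|[|j]]] j3] //=; rewrite ?ltnn ?eqxx ?andbT //;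
  by [lia | clear i3 j3; lia].
Qed.

Lemma card_perm_lt n (s : 'S_n) (k : nat) : (k <= n)%N ->
  #|[set i | (s i < k)%N]| = k.
Proof.
move=> kn; rewrite -(card_imset _ (@perm_inj _ s)).
have -> : s @: [set i | (s i < k)%N] = [set v : 'I_n | (v < k)%N].
  apply/setP => v; rewrite inE; apply/imsetP/idP => [[i]|vk].
    by rewrite inE => ik ->.
  by exists (s^-1 v)%g; rewrite ?inE permKV.
rewrite -sum1dep_card -(big_ord_widen n (fun=> 1%N)) //.
by rewrite sum1_card card_ord.
Qed.

Section CaseA.
Variable n : nat.
Let cellA := cell n (fun=> 0%N) id.

(** The letters [s 0, ..., s i] fill the interval of length [i + 1] that starts at [g (n - 1 - i)],
    so time runs backwards through the word. A step of [g] means that [s i] is a new minimum, no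
    step that it is a new maximum. *)
Definition specA (s : 'S_n) (g : nat -> nat) : Prop := forall i : 'I_n,
  s i = (if i == 0%N :> nat then g n.-1
         else if g (n - i)%N == (g (n.-1 - i)%N).+1 then g (n.-1 - i)%N
         else (g (n.-1 - i) + i)%N) :> nat.

Definition extremal (s : 'S_n) : Prop := forall i : 'I_n,
  (forall i' : 'I_n, (i' < i)%N -> (s i' < s i)%N) \/
  (forall i' : 'I_n, (i' < i)%N -> (s i < s i')%N).

(** A letter with both a smaller and a greater letter before it completes a 132 or a 312, according
    to the order of these two. *)
Lemma avoids_extremal (s : 'S_n) :
  avoids s [:: 1; 3; 2]%N && avoids s [:: 3; 1; 2]%N <-> extremal s.
Proof.
rewrite /avoids; split => [/andP[/contains_pattern3 - /(_ isT) H1]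
    /contains_pattern3 - /(_ isT) H2 i|H].
  case: (boolP [exists i' : 'I_n, (i' < i)%N && (s i' < s i)%N]); last first.
    move/existsPn => K; right => i' i'i; have := K i'; have := perm_neq s i'i; lia.
  case/existsP => a /andP[ai sai]; left => b bi.
  case: (ltnP (s b) (s i)) => // sib; have := perm_neq s bi => nbi.
  exfalso; case: (ltngtP a b) => [ab|ba|/val_inj eab]; last by move: sai sib; rewrite eab; lia.
    by apply: H1; exists a, b, i; split; lia.
  by apply: H2; exists b, a, i; split; lia.
by apply/andP; split; apply/contains_pattern3 => // -[a [b [c [abc ab ac bc]]]];
  have := perm_neq s (i := a) (j := b); have := perm_neq s (i := a) (j := c);
  have := perm_neq s (i := b) (j := c);
  case: (H c) => K; have := K a; have := K b; lia.
Qed.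

Notation is_pathA := (is_path n.-1 (fun=> 0%N) id).

Lemma extremal_path (s : 'S_n) : extremal s -> exists2 g, is_pathA g & specA s g.
Proof.
move=> ext_s; case: (posnP n) => [n0|n_gt0].
  exists (fun=> 0%N); first by split => // t; rewrite n0.
  by move=> i; exfalso; have := ltn_ord i; lia.
have [z z0] : exists z : 'I_n, z = 0%N :> nat by exists (Ordinal n_gt0).
(* This is the least letter up to position [k]: later letters below [s z] are new minima, hence are
   the letters below that prefix. *)
pose c k := #|[set i : 'I_n | (k < i)%N && (s i < s z)%N]|.
have c_step (i : 'I_n) : (0 < i)%N -> c i.-1 = (c i + (s i < s z))%N.
  move=> i0; rewrite /c (cardsD1 i) inE ltn_predL i0 addnC; congr (_ + _)%N.
  apply: eq_card => j; rewrite !inE -(inj_eq val_inj) /=.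
  by case: (s j < s z)%N; rewrite ?andbF ?andbT //; lia.
(* The letter [s i] is the number of letters below it: for a new maximum these are the [i] earlier
   letters and the later ones below [s z], otherwise only the latter. *)
have cE (i : 'I_n) : (s i : nat) =
    if (0 < i)%N && ~~ (s i < s z)%N then (c i + i)%N else c i.
  rewrite -[LHS](card_perm_lt s (ltnW (ltn_ord (s i)))); case: ifP.
    move=> /andP[i0 siz].
    have above (j : 'I_n) : (j < i)%N -> (s j < s i)%N.
      case: (ext_s i) => [K|/(_ z)]; [exact: K|by rewrite z0 => /(_ i0); move: siz; lia].
    have -> : [set j | (s j < s i)%N] =
        [set j : 'I_n | (i < j)%N && (s j < s z)%N] :|: [set j : 'I_n | (j < i)%N].
      apply/setP => j; rewrite !inE; case: (ltngtP i j) => [ij|ji|/val_inj->].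
      - rewrite orbF /=; have zi := above z.
        case: (ext_s j) => K; first by have := K i ij; have := K z; lia.
        by have := K i ij; have := K z; lia.
      - by rewrite orbT above.
      - by rewrite ltnn.
    rewrite cardsU (_ : _ :&: _ = set0) ?cards0 ?subn0; last first.
      by apply/setP => j; rewrite !inE; lia.
    congr (_ + _)%N; rewrite -[RHS](card_perm_lt 1%g (ltnW (ltn_ord i))).
    by apply: eq_card => j; rewrite !inE perm1.
  move=> Hi; apply: eq_card => j; rewrite !inE.
  have below (k : 'I_n) : (k < i)%N -> (s i < s k)%N.
    move=> ki; case: (ext_s i) => [K|]; last exact.
    have i0 : (0 < i)%N by lia.
    by have := K z; move: Hi; rewrite i0 /=; lia.
  have iz : (s i <= s z)%N.
    case: (posnP i) => i0; last by have := below z; lia.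
    by rewrite (_ : i = z) //; apply: val_inj; rewrite /= z0 i0.
  case: (ltngtP i j) => [ij|ji|/val_inj->] /=; last by rewrite ltnn.
    case: (posnP i) => i0; first by rewrite (_ : i = z) //; apply: val_inj; rewrite /= z0 i0.
    case: (ext_s j) => K; have := K i ij; have := K z; lia.
  by have := below j ji; lia.
have c_last k : (n.-1 <= k)%N -> c k = 0%N.
  move=> nk; apply/eqP; rewrite cards_eq0; apply/eqP/setP => j; rewrite !inE.
  by have := ltn_ord j; lia.
exists (fun t => c (n.-1 - t)%N).
  have step t : (t < n.-1)%N ->
      (c (n.-1 - t) <= c (n.-1 - t.+1) <= (c (n.-1 - t)).+1)%N.
    move=> tn; have tn' : (n.-1 - t < n)%N by lia.
    have := c_step (Ordinal tn') _ => /= /(_ ltac:(lia)).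
    rewrite (_ : (n.-1 - t).-1 = (n.-1 - t.+1)%N); last by lia.
    by move->; case: (s _ < s z)%N; lia.
  split=> // t tn /=; elim: t tn => [_|t IH tn]; first by rewrite c_last // subn0.
  by have := IH (ltnW tn); have := step t tn; lia.
move=> i; have := ltn_ord i => i_n; rewrite cE subnn.
case: eqP => [->|/eqP i0] //=.
rewrite (_ : (n.-1 - (n.-1 - i) = i)%N); last by lia.
rewrite (_ : (n.-1 - (n - i) = i.-1)%N); last by lia.
rewrite lt0n i0 c_step ?lt0n //=; case: (s i < s z)%N; rewrite /= ?addn1 ?addn0 ?eqxx //.
by rewrite (_ : (c i == (c i).+1) = false) //; lia.
Qed.

Lemma path_extremal g : is_pathA g -> exists2 s : 'S_n, extremal s & specA s g.
Proof.
case=> gb gs.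
pose f (i : nat) := if i == 0%N then g n.-1
  else if g (n - i)%N == (g (n.-1 - i)%N).+1 then g (n.-1 - i)%N
  else (g (n.-1 - i) + i)%N.
have g_step k : (k.+1 < n)%N ->
    (g (n.-1 - k.+1) <= g (n - k.+1) <= (g (n.-1 - k.+1)).+1)%N.
  move=> kn; have := gs (n.-1 - k.+1)%N.
  by rewrite (_ : (n.-1 - k.+1).+1 = (n - k.+1)%N); lia.
have f_bound k i : (k < n)%N -> (i <= k)%N ->
    (g (n.-1 - k) <= f i <= g (n.-1 - k) + k)%N.
  elim: k => [|k IH] kn ik.
    by rewrite /f (_ : i = 0%N) ?eqxx ?subn0; lia.
  have := g_step k kn; case: (ltngtP i k.+1) ik => // [ik _|-> _].
    have := IH (ltnW kn) ik; rewrite (_ : (n.-1 - k)%N = (n - k.+1)%N); lia.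
  by rewrite /f /=; case: eqP; lia.
(* Each value lies beyond all earlier ones on the side prescribed by [g], which gives both
   injectivity and extremality. *)
have f_lt i k : (k < n)%N -> (i < k)%N ->
    if g (n - k)%N == (g (n.-1 - k)%N).+1 then (f k < f i)%N else (f i < f k)%N.
  case: k => // k kn ik; have := g_step k kn.
  have := f_bound k i (ltnW kn) ik.
  rewrite (_ : (n.-1 - k)%N = (n - k.+1)%N); last by lia.
  by move: (f i) => fi; rewrite /f /=; case: eqP; lia.
have f_n (i : 'I_n) : (f i < n)%N.
  have := ltn_ord i => i_n; have := f_bound i i i_n (leqnn i).
  by have := gb (n.-1 - i)%N (leq_subr _ _) => /=; lia.
pose F (i : 'I_n) := Ordinal (f_n i).
have F_inj : injective F.
  move=> i j /(congr1 val) /= e; apply: val_inj => /=.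
  by case: (ltngtP i j) => // ij; [have := f_lt i j (ltn_ord j) ij
                                 |have := f_lt j i (ltn_ord i) ij];
     case: ifP; rewrite e ltnn.
exists (perm F_inj); last by move=> i; rewrite permE.
move=> i; case E : (g (n - i)%N == (g (n.-1 - i)%N).+1); [right|left] => j ji;
  by have := f_lt j i (ltn_ord i) ji; rewrite E !permE.
Qed.

(** * The affine map from values on cells to matrices *)

Section Matrix.
Variable R : realType.
Local Notation X := (@ext n (fun=> 0%N) id R).

(* [prefixA m y i v] is the sum of the entries [(0, v), ..., (i, v)]; for a
   permutation whose first letters [s 0, ..., s i] fill the interval
   [[g, g + i]], it is [1] exactly when [g <= v <= g + i]. *)
Definition prefixA (m : R) (y : cellA -> R) (i v : nat) : R :=
  X m y (n.-1 - i) (v - i) - X m y (n.-1 - i) v.+1.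

Definition entryA (m : R) (y : cellA -> R) (i v : nat) : R :=
  prefixA m y i v - (if i is i'.+1 then prefixA m y i' v else 0).

Definition PhiA (m : R) (y : cellA -> R) : 'M[R]_n :=
  \matrix_(i, v) entryA m y i v.

Lemma PhiA_linear a m y m' y' :
  PhiA (a * m + m') (fun q => a * y q + y' q) = a *: PhiA m y + PhiA m' y'.
Proof.
apply/matrixP => i v; rewrite !mxE /entryA /prefixA.
by case: (i : nat) => [|k]; rewrite !ext_linear; ring.
Qed.

Lemma PhiA_int m y : m \is a Num.int -> (forall q, y q \is a Num.int) ->
  forall i j, PhiA m y i j \is a Num.int.
Proof.
move=> mi yi i v; rewrite mxE /entryA /prefixA.
by case: (i : nat) => [|k]; rewrite ?subr0 !rpredB // ext_int.
Qed.

Lemma PhiA_int_inv m y : m \is a Num.int ->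
  (forall i j, PhiA m y i j \is a Num.int) -> forall q, y q \is a Num.int.
Proof.
move=> mi Mi.
have pi i v : (i < n)%N -> (v < n)%N -> prefixA m y i v \is a Num.int.
  move=> + vn; elim: i => [|i IH] i_n.
    by have := Mi (Ordinal i_n) (Ordinal vn); rewrite mxE /entryA subr0.
  have -> : prefixA m y i.+1 v = entryA m y i.+1 v + prefixA m y i v.
    by rewrite /entryA subrK.
  apply: rpredD; last exact: IH (ltnW i_n).
  by have := Mi (Ordinal i_n) (Ordinal vn); rewrite mxE.
(* The prefix sum at [k] expresses the value at [k + 1] by the one at [k - i]. The recursion starts
   at height 0, where the value is the constant [m]. *)
have xi i k : (i < n)%N -> (k <= n)%N -> X m y (n.-1 - i) k \is a Num.int.
  move=> i_n; have [d] := ubnP k; elim: d k => // d IH [|k] kd kn.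
    by rewrite ext_out.
  have := pi i k i_n kn; rewrite /prefixA => Hp.
  have -> : X m y (n.-1 - i) k.+1 = X m y (n.-1 - i) (k - i) - prefixA m y i k.
    by rewrite /prefixA subKr.
  apply: rpredB => //.
  by apply: IH; lia.
move=> q; have := cellP q; rewrite /in_diagram -(ext_cell m y) => /and3P[_ kt tn].
have := xi (n.-1 - crow q)%N (ccol q); rewrite subKn; last by lia.
by apply; move: kt => /=; lia.
Qed.

Lemma PhiA_perm (s : 'S_n) F g : is_pathA g -> specA s g ->
  @path_of n n.-1 (fun=> 0%N) id R F g -> perm_mx s = PhiA 1 (indic R F).
Proof.
case=> gb gs sg Fg; apply/matrixP => i v; rewrite !mxE.
rewrite (_ : (s i == v) = (s i == v :> nat)) // sg /entryA /prefixA.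
have i_n := ltn_ord i; have vn := ltn_ord v.
move: (i : nat) (v : nat) i_n vn => {sg}{}i {}v i_n vn.
case: i i_n => [|i] i_n /=.
  rewrite subr0 !Fg ?leq_subr // !subn0.
  apply/eqP; rewrite eq_sym subr_eq -natrD eqr_nat; lia.
rewrite !Fg ?leq_subr //.
have := gs (n.-1 - i.+1)%N; rewrite (_ : (n.-1 - i.+1).+1 = (n - i.+1)%N); last by lia.
move=> /(_ ltac:(lia)) gstep.
rewrite (_ : (n.-1 - i = n - i.+1)%N); last by lia.
have := gb (n.-1 - i.+1)%N (leq_subr _ _).
move: gstep; move: (g _) (g _) => c c' cc' /= c_le.
(* An identity of indicators with the negative terms moved across, so that it holds in the natural
   numbers. *)
have key : (((if c == c'.+1 then c' else c' + i.+1) == v) + (v < c') +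
  (v - i <= c) = (v - i.+1 <= c') + (v < c))%N.
  by case: (c =P c'.+1) => ecc; lia.
by move/(congr1 (fun k => k%:R : R)): key; rewrite !natrD; lra.
Qed.

End Matrix.

Lemma palindromic_B_132_312 (R : realType) :
  has_palindromic_hstar (B_132_312 R n).
Proof.
have hi_ltn t : (t < n)%N -> (t < n)%N by [].
have n_le : (n <= n.-1.+1)%N by lia.
have lo_hi_n t : (t <= n.-1)%N -> (n <= t)%N -> 0%N = t by lia.
have step t : (t <= t.+1 <= t.+1)%N by rewrite leqnSn leqnn.
have ex t k := @cell_exists n (fun=> 0%N) id hi_ltn t k.
(* Both kinds of cover raise [crow - 2 ccol] by one. The shift by [n] gives rank 1 to the cell
   [(n-1, n-1)], and the greatest rank, at [(n-1, 1)], is [2n - 3]. *)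
pose r (q : cellA) := (crow q + n - (ccol q).*2)%N.
have rng (q : cellA) : (0 < ccol q <= crow q)%N /\ (crow q < n)%N.
  by have /and3P[/= -> -> ->] := cellP q.
have H : forall s : 'S_n, s \in [set s : 'S_n |
    avoids s [:: 1; 3; 2]%N && avoids s [:: 3; 1; 2]%N] <-> extremal s.
  by move=> s; rewrite inE; exact: avoids_extremal.
apply: (@order_polytope_palindromic R n cellA (@cell_cov n _ _) r (n.*2 - 3)%N
  _ _ _ _ _ (@PhiA R)).
- move=> p q; rewrite /cell_cov /r => pq.
  by have := rng p; have := rng q; case/orP: pq; lia.
- move=> q; have := rng q; rewrite /r => rq.
  case: (ltnP (ccol q) (crow q)) => kt.
    have [|p [p1 p2]] := ex (crow q).-1 (ccol q); first by rewrite /in_diagram; lia.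
    by right; exists p; rewrite /cell_cov p1 p2; lia.
  case: (ltnP (crow q).+1 n) => tn; last by left; lia.
  have [|p [p1 p2]] := ex (crow q).+1 (ccol q).+1; first by rewrite /in_diagram; lia.
  by right; exists p; rewrite /cell_cov p1 p2; lia.
- move=> q; have := rng q; rewrite /r => rq.
  case: (ltnP (crow q).+1 n) => tn.
    have [|p [p1 p2]] := ex (crow q).+1 (ccol q); first by rewrite /in_diagram; lia.
    by right; exists p; rewrite /cell_cov p1 p2; lia.
  case: (ltnP 1 (ccol q)) => k1; last by left; lia.
  have [|p [p1 p2]] := ex (crow q).-1 (ccol q).-1; first by rewrite /in_diagram; lia.
  by right; exists p; rewrite /cell_cov p1 p2; lia.
- by move=> q; have := rng q; rewrite /r; lia.
(* For [n <= 1] the truncated [n.*2 - 3] is 0; otherwise [(1, 1)] is a cell. *)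
- case: (ltnP 1 n) => n1; last by lia.
  have [|p _] := ex 1%N 1%N; first by rewrite /in_diagram.
  by move=> Q0; have := card0_eq Q0 p; rewrite inE.
- exact: PhiA_linear.
- exact: PhiA_int.
- exact: PhiA_int_inv.
- move=> s /H/extremal_path[g gp sg].
  have [F fF Fg] := filter_of_path hi_ltn n_le lo_hi_n R gp.
  by exists F => //; apply: PhiA_perm gp sg Fg.
- move=> F fF; have [g gp Fg] := path_of_filter hi_ltn n_le lo_hi_n R
    (conj erefl erefl) (fun=> isT) step (fun _ _ => isT) fF.
  have [s es sg] := path_extremal gp.
  by exists s; [apply/H|apply: PhiA_perm gp sg Fg].
Qed.

End CaseA.

(** * Alternating permutations avoiding 123 *)

Section CaseB.
Variable n : nat.
Local Notation loB := uphalf.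
Local Notation hiB := (fun t => minn t (uphalf n)).
Let cellB := cell n loB hiB.
Notation is_pathB := (is_path n loB hiB).

(* The peaks of an alternating word, together with its last letter. *)
Definition peak (i : nat) : bool := odd i || (i == n.-1).

(** Halving numbers the positions of each of the two classes from left to right, starting at 0; this
    includes the last position when [n] is odd. *)
Lemma peak_half_lt i j : peak i = peak j -> (i < j < n)%N -> (i./2 < j./2)%N.
Proof.
move=> pij /andP[ij jn].
suff : j != i.+1 \/ odd i by case: (boolP (odd i)) => oi; lia.
case: (boolP (odd i)) => oi; [by right|left].
apply: contra_eqN pij => /eqP ej; rewrite /peak ej /= oi (negPf oi) /=.
by lia.
Qed.

Lemma peak_half_eq i j : peak i = peak j -> (i < n)%N -> (j < n)%N ->
  (i == j) = (i./2 == j./2).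
Proof.
move=> pij i_n j_n; case: (ltngtP i j) => [ij|ji|->]; rewrite ?eqxx //.
  by rewrite ltn_eqF // peak_half_lt // ij.
by rewrite gtn_eqF // peak_half_lt // ji.
Qed.

(* [position g t] is the position of the letter [n - t] in the word encoded by
   [g], where [g t] is the number of peaks among the [t] largest letters. *)
Definition position (g : nat -> nat) (t : nat) : nat :=
  if g t == (g t.-1).+1 then minn (g t).*2.-1 n.-1 else ((t - g t).*2 - 2)%N.

Definition specB (s : 'S_n) (g : nat -> nat) : Prop :=
  forall i : 'I_n, i = position g (n - s i) :> nat.

Lemma path_steps g t : is_pathB g -> (0 < t <= n)%N ->
  [/\ uphalf t <= g t <= t, uphalf t.-1 <= g t.-1 <= t.-1, g t <= uphalf n
    & g t.-1 <= g t <= (g t.-1).+1]%N.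
Proof.
case=> gb gs; case: t => //= t tn.
by have := gb t (ltnW tn); have := gb t.+1 tn; have := gs t tn; split; lia.
Qed.

Lemma path_mono g t t' : is_pathB g -> (t <= t' <= n)%N ->
  (g t <= g t')%N /\ (t - g t <= t' - g t')%N.
Proof.
move=> gp; elim: t' => [|t' IH] tt'; first by have -> : t = 0%N by lia.
case: (ltngtP t t'.+1) => lt_t; [|by lia|by rewrite lt_t].
have [|IH1 IH2] := IH; first by lia.
have [|_ _ _ st] := path_steps (t := t'.+1) gp; first by lia.
by split; move: st => /=; lia.
Qed.

Lemma position_ltn g t : is_pathB g -> (0 < t <= n)%N -> (position g t < n)%N.
Proof.
by move=> gp tn; have [] := path_steps gp tn; rewrite /position; case: eqP; lia.
Qed.

Lemma position_peak g t : is_pathB g -> (0 < t <= n)%N ->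
  peak (position g t) = (g t == (g t.-1).+1).
Proof.
move=> gp tn; have [] := path_steps gp tn; rewrite /position /peak.
by case: eqP => e; lia.
Qed.

Lemma position_half g t : is_pathB g -> (0 < t <= n)%N ->
  if peak (position g t) then g t = (position g t)./2.+1 /\ g t.-1 = (position g t)./2
  else (t - g t = (position g t)./2.+1)%N /\ (t.-1 - g t.-1 = (position g t)./2)%N.
Proof.
move=> gp tn; rewrite position_peak //; have [] := path_steps gp tn.
by rewrite /position; case: eqP => e; split; lia.
Qed.

(** At equal positions the same class count would have to make the same increase at two different
    times. *)
Lemma position_inj g t t' : is_pathB g -> (0 < t <= n)%N -> (0 < t' <= n)%N ->
  position g t = position g t' -> t = t'.
Proof.
move=> gp; wlog tt : t t' / (t <= t')%N => [W tn tn' e|tn tn' e].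
  by case: (leqP t t') => [|/ltnW] tt; [|symmetry]; exact: W.
case: (ltngtP t t') tt => // tt _.
have mono := @path_mono g t t'.-1 gp _.
have := position_half gp tn; have := position_half gp tn'; rewrite e.
by have [] := mono; [lia|case: ifP; lia].
Qed.

Lemma specB_half (s : 'S_n) g (i : 'I_n) : is_pathB g -> specB s g ->
  let t := (n - s i)%N in
  if peak i then g t = i./2.+1 /\ g t.-1 = i./2
  else (t - g t = i./2.+1)%N /\ (t.-1 - g t.-1 = i./2)%N.
Proof.
move=> gp sg /=; have := @position_half g (n - s i)%N gp; rewrite -sg; apply.
by have := ltn_ord (s i); lia.
Qed.

Lemma specB_same_type (s : 'S_n) g (i j : 'I_n) : is_pathB g -> specB s g ->
  peak i = peak j -> (i < j)%N -> (s j < s i)%N.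
Proof.
move=> gp sg ij lt_ij; rewrite ltnNge; apply/negP => le_s.
have := peak_half_lt ij; rewrite lt_ij ltn_ord => /(_ isT) lt_half.
have [|g_le c_le] := @path_mono g (n - s j)%N (n - s i)%N gp.
  by rewrite leq_subr leq_sub2l.
have := specB_half i gp sg; have := specB_half j gp sg; rewrite ij /=.
case: ifP => _ [ej _] [ei _].
  by move: g_le; rewrite ej ei ltnS leqNgt lt_half.
by move: c_le; rewrite ej ei ltnS leqNgt lt_half.
Qed.

(** Were a non-peak greater than a neighbouring peak, non-peaks would outnumber peaks among the
    letters down to it, against [uphalf t <= g t]. A descent to a last letter that counts as a peak
    comes from [specB_same_type]. *)
Lemma specB_alternating (s : 'S_n) g : is_pathB g -> specB s g -> alternating s.
Proof.
move=> gp sg; apply/forallP => i; apply/forallP => j; apply/implyP => /eqP ij.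
have lt_ij : (i < j)%N by rewrite ij.
have sij := perm_neq s lt_ij.
have i_n := ltn_ord (s i); have j_n := ltn_ord (s j).
have j_lt := ltn_ord j.
have si := specB_half i gp sg; have sj := specB_half j gp sg.
case: (boolP (odd i)) => oi.
  case: (boolP (peak j)) => pj.
    by apply: (specB_same_type gp sg) => //; rewrite pj /peak oi.
  move: si sj; rewrite (negPf pj) {1}/peak oi /= => si sj.
  rewrite ltnNge; apply/negP => le_s.
  have [|] := @path_mono g (n - s j)%N (n - s i).-1 gp; first by lia.
  have [|] := path_steps (t := n - s j) gp; first by lia.
  by lia.
have pi : peak i = false by rewrite /peak; lia.
have pj : peak j by rewrite /peak ij /= oi.
move: si sj; rewrite pi pj /= => si sj.
rewrite ltnNge; apply/negP => le_s.
have [|] := @path_mono g (n - s i)%N (n - s j).-1 gp; first by lia.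
have [|] := path_steps (t := n - s i) gp; first by lia.
by lia.
Qed.

(** Of three letters two belong to the same class, and each class is decreasing. *)
Lemma specB_avoids (s : 'S_n) g : is_pathB g -> specB s g ->
  avoids s [:: 1; 2; 3]%N.
Proof.
move=> gp sg; apply/contains_pattern3 => // -[a [b [c [abc sab sac sbc]]]].
have H := specB_same_type gp sg.
case: (eqVneq (peak a) (peak b)) => eab; first by have := H a b eab; lia.
case: (eqVneq (peak a) (peak c)) => eac; first by have := H a c eac; lia.
have ebc : peak b = peak c by move: eab eac; do 3!case: peak.
by have := H b c ebc; lia.
Qed.

Lemma path_perm g : is_pathB g -> exists2 s : 'S_n,
  alternating s && avoids s [:: 1; 2; 3]%N & specB s g.
Proof.
move=> gp.
have rng (v : 'I_n) : (0 < n - v <= n)%N by have := ltn_ord v; lia.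
(* Sending letters to positions gives the inverse of the permutation sought. *)
pose u (v : 'I_n) := Ordinal (position_ltn gp (rng v)).
have u_inj : injective u.
  move=> v w /(congr1 val) /= /(position_inj gp (rng v) (rng w)) e.
  by apply: val_inj => /=; have := ltn_ord v; have := ltn_ord w; lia.
have sg : specB (perm u_inj)^-1 g.
  move=> i; set s := (_^-1)%g.
  by rewrite -[LHS](congr1 (@nat_of_ord n) (permKV (perm u_inj) i)) permE.
exists (perm u_inj)^-1%g => //.
by rewrite (specB_alternating gp sg) (specB_avoids gp sg).
Qed.

Lemma alternating_asc (s : 'S_n) (i j : 'I_n) : alternating s ->
  j = i.+1 :> nat -> ~~ odd i -> (s i < s j)%N.
Proof.
move=> /forallP/(_ i)/forallP/(_ j)/implyP alt ij oi.
by move: alt; rewrite ij eqxx (negPf oi); apply.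
Qed.

(** A peak other than the last letter has a smaller letter just before it, and a non-peak a greater
    one just after it; so an ascent within a class extends to a 123. *)
Lemma avoiding_same_type (s : 'S_n) (i j : 'I_n) : alternating s ->
  avoids s [:: 1; 2; 3]%N -> peak i = peak j -> (i < j)%N -> (s j < s i)%N.
Proof.
move=> alt /contains_pattern3 - /(_ isT) no123 ij lt_ij.
have nij := perm_neq s lt_ij; have j_n := ltn_ord j.
rewrite ltnNge; apply/negP => le_s; apply: no123.
case: (boolP (peak i)) => pi.
  have oi : odd i by move: pi; rewrite /peak; lia.
  have h_lt : (i.-1 < n)%N by lia.
  pose h := Ordinal h_lt; exists h, i, j.
  have := @alternating_asc s h i alt; rewrite /= => H.
  have {}H : (s h < s i)%N by apply: H; lia.
  by split; rewrite /=; lia.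
have pj : peak j = false by rewrite -ij; exact: negPf.
have h_lt : (j.+1 < n)%N by move: pj; rewrite /peak; lia.
pose h := Ordinal h_lt; exists i, j, h.
have H : (s j < s h)%N.
  by apply: (alternating_asc alt) => //; move: pj; rewrite /peak; lia.
by split; rewrite /=; lia.
Qed.

Lemma card_peak_lt (b : bool) m : (m <= n.-1)%N ->
  #|[set j : 'I_n | (peak j == b) && (j < m)%N]| = if b then m./2 else uphalf m.
Proof.
elim: m => [|m IH] mn.
  rewrite (_ : [set j | _] = set0) ?cards0; first by case: b.
  by apply/setP => j; rewrite !inE ltn0 andbF.
have m_n : (m < n)%N by lia.
rewrite (cardsD1 (Ordinal m_n)) inE /= ltnSn andbT.
have -> : [set j : 'I_n | (peak j == b) && (j < m.+1)%N] :\ Ordinal m_n =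
    [set j : 'I_n | (peak j == b) && (j < m)%N].
  by apply/setP => j; rewrite !inE -(inj_eq val_inj) /=; case: (_ == b); lia.
by rewrite (IH (ltnW mn)) /peak; case: b {IH}; lia.
Qed.

Lemma avoiding_path (s : 'S_n) : alternating s -> avoids s [:: 1; 2; 3]%N ->
  exists2 g, is_pathB g & specB s g.
Proof.
move=> alt av.
pose c (b : bool) (t : nat) := #|[set j : 'I_n | (peak j == b) && (n - t <= s j)%N]|.
have c_sum t : (t <= n)%N -> (c true t + c false t = t)%N.
  move=> tn; pose U := [set j | (n - t <= s j)%N].
  have cU : #|U| = t.
    have -> : U = ~: [set j | (s j < n - t)%N].
      by apply/setP => j; rewrite !inE -leqNgt.
    by rewrite cardsCs setCK card_perm_lt ?leq_subr // card_ord subKn.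
  rewrite -[RHS]cU -(cardsID [set j : 'I_n | peak j] U); congr (_ + _)%N;
    by apply: eq_card => j; rewrite !inE; case: peak; rewrite ?andbT ?andbF.
have c_mono b t t' : (t <= t')%N -> (c b t <= c b t')%N.
  move=> tt; apply: subset_leq_card; apply/subsetP => j; rewrite !inE.
  by case: (_ == b) => //=; lia.
(* The letters of the class of [i] greater than [s i] are those to its left, since each class is
   decreasing. *)
have c_at (i : 'I_n) : c (peak i) (n - s i)%N = i./2.+1 /\
    c (peak i) (n - s i).-1%N = i./2.
  have i_n := ltn_ord i; have si_n := ltn_ord (s i).
  have e2 : c (peak i) (n - s i).-1%N = i./2.
    have := card_peak_lt (peak i) (m := i); rewrite (_ : (i <= n.-1)%N); last by lia.
    move=> /(_ isT) H; transitivity (if peak i then i./2 else uphalf i); last first.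
      by rewrite /peak; case: ifP; lia.
    rewrite -[RHS]H; apply: eq_card => j; rewrite !inE.
    case: eqP => //= pj; have sj_n := ltn_ord (s j).
    case: (ltngtP j i) => [ji|ij|/val_inj->]; last by lia.
      by have := avoiding_same_type alt av pj ji; lia.
    by have := avoiding_same_type alt av (esym pj) ij; lia.
  split=> //; rewrite -e2 /c (cardsD1 i) inE eqxx subKn ?(ltnW si_n) // leqnn add1n.
  congr (_.+1); apply: eq_card => j; rewrite !inE; have sj_n := ltn_ord (s j).
  case: (eqVneq j i) => [->|ji]; first by lia.
  case: (_ == peak i) => //=.
  have : s j != s i :> nat by rewrite (inj_eq val_inj) (inj_eq perm_inj).
  by lia.
(* A non-peak is followed by a peak with a greater letter, and passing to the next position is
   injective. *)
have c_le t : (t <= n)%N -> (c false t <= c true t)%N.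
  move=> tn; case: (posnP n) => [n0|n_gt0].
    by have := c_sum t tn; lia.
  have nE : n = n.-1.+1 by lia.
  pose next (i : 'I_n) : 'I_n := insubd i i.+1.
  have nextE (i : 'I_n) : ~~ peak i -> next i = i.+1 :> nat.
    move=> pi; rewrite /next val_insubd ifT //.
    by move: pi; have := ltn_ord i; rewrite /peak; lia.
  rewrite /c -(card_in_imset (f := next)); last first.
    move=> i j; rewrite !inE => /andP[/eqP pi _] /andP[/eqP pj _].
    move/(congr1 (@nat_of_ord n)); rewrite !nextE ?pi ?pj // => -[].
    exact: val_inj.
  apply: subset_leq_card; apply/subsetP => _ /imsetP[i + ->]; rewrite !inE.
  move=> /andP[/eqP/negbT pi ti]; have ni := nextE i pi.
  have oi : ~~ odd i by move: pi; rewrite /peak; lia.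
  have := alternating_asc alt ni oi.
  by rewrite /peak ni /= oi; lia.
have c_top t : (t <= n)%N -> (c true t <= uphalf n)%N.
  move=> tn; case: (posnP n) => [n0|n_gt0].
    by have := c_sum t tn; lia.
  have last_n : (n.-1 < n)%N by lia.
  pose top := Ordinal last_n.
  have := card_peak_lt true (leqnn n.-1) => H.
  have : (c true t <= (#|[set j : 'I_n | (peak j == true) && (j < n.-1)%N]|).+1)%N.
    rewrite -add1n -(cards1 top); apply: leq_trans (leq_card_setU _ _).
    apply: subset_leq_card; apply/subsetP => j; rewrite !inE -(inj_eq val_inj) /=.
    by have := ltn_ord j; case: peak; lia.
  by rewrite H; lia.
exists (c true).
  split=> t tn.
    by have := c_sum t tn; have := c_le t tn; have := c_top t tn; lia.
  have := c_sum t (ltnW tn); have := c_sum t.+1 tn.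
  by have := c_mono true _ _ (leqnSn t); have := c_mono false _ _ (leqnSn t); lia.
move=> i; have i_n := ltn_ord i; have si_n := ltn_ord (s i).
have := c_sum (n - s i)%N (leq_subr _ _); have := c_sum (n - s i).-1%N _ => /(_ ltac:(lia)).
have [] := c_at i; rewrite /position; case: (boolP (peak i)) => pi.
  by move=> -> ->; rewrite eqxx; move: pi; rewrite /peak; lia.
move=> e1 e2 e3 e4; clearbody c; case: eqP => [|_]; first by lia.
have -> : (n - s i - c true (n - s i) = i./2.+1)%N by lia.
by move: pi; rewrite /peak; case: (boolP (odd i)) => //= oi _; lia.
Qed.

(** * The affine map for alternating permutations *)

Section Matrix.
Variable R : realType.
Local Notation X := (@ext n loB hiB R).

(* [tailB m y i t] is the sum of the last [t] entries of row [i]. *)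
Definition tailB (m : R) (y : cellB -> R) (i t : nat) : R :=
  if peak i then X m y t i./2.+1 else m - X m y t (t - i./2).

(** For a permutation matrix the tail is 1 when the letter at [i] is among the [t] largest, that is,
    when more than [i./2] of these belong to the class of [i]. For a non-peak this says
    [t - g t > i./2], the negation of [t - i./2 <= g t]. *)
Definition PhiB (m : R) (y : cellB -> R) : 'M[R]_n :=
  \matrix_(i, v) (tailB m y i (n - v) - tailB m y i (n - v.+1)).

Lemma PhiB_linear a m y m' y' :
  PhiB (a * m + m') (fun q => a * y q + y' q) = a *: PhiB m y + PhiB m' y'.
Proof.
apply/matrixP => i v; rewrite !mxE /tailB.
by case: (peak i); rewrite !ext_linear; ring.
Qed.

Lemma PhiB_int m y : m \is a Num.int -> (forall q, y q \is a Num.int) ->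
  forall i j, PhiB m y i j \is a Num.int.
Proof.
move=> mi yi i v; rewrite mxE /tailB.
by case: (peak i); rewrite !rpredB // ext_int.
Qed.

Lemma PhiB_int_inv m y : m \is a Num.int ->
  (forall i j, PhiB m y i j \is a Num.int) -> forall q, y q \is a Num.int.
Proof.
move=> mi Mi.
have ti i t : (i < n)%N -> (t <= n)%N -> tailB m y i t \is a Num.int.
  move=> i_n; elim: t => [_|t IH tn].
    by rewrite /tailB; case: peak; rewrite ext_out ?subrr ?rpred0 //=
      /in_diagram; lia.
  have v_n : (n - t.+1 < n)%N by lia.
  have := Mi (Ordinal i_n) (Ordinal v_n); rewrite mxE /=.
  rewrite (_ : (n - (n - t.+1) = t.+1)%N); last by lia.
  rewrite (_ : (n - (n - t.+1).+1 = t)%N); last by lia.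
  move=> H; have -> : tailB m y i t.+1 =
      tailB m y i t.+1 - tailB m y i t + tailB m y i t by rewrite subrK.
  by apply: rpredD => //; apply: IH; exact: ltnW.
move=> q; have := cellP q; rewrite /in_diagram -(ext_cell m y) => /and3P[tk kt tn].
(* The cell [(t, k)] is read in the row of the peak whose half is [k - 1]. *)
have := ti (minn (ccol q).*2.-1 n.-1) (crow q) _ (ltnW tn); rewrite /tailB.
rewrite ifT; last by move: tk kt; rewrite /peak; lia.
rewrite (_ : (minn (ccol q).*2.-1 n.-1)./2.+1 = ccol q); last by lia.
by apply; lia.
Qed.

Lemma PhiB_perm (s : 'S_n) F g : is_pathB g -> specB s g ->
  @path_of n n loB hiB R F g -> perm_mx s = PhiB 1 (indic R F).
Proof.
move=> gp sg Fg; apply/matrixP => i v; rewrite !mxE.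
have i_n := ltn_ord i; have v_n := ltn_ord v.
have -> : (s i == v) = (i == position g (n - v) :> nat).
  apply/eqP/eqP => [<-|e]; first exact: sg.
  have := sg ((s^-1)%g v); rewrite permKV -e => /val_inj <-.
  by rewrite permKV.
rewrite (_ : (n - v.+1)%N = (n - v).-1); last by lia.
have tn : (0 < n - v <= n)%N by lia.
move: (n - v)%N tn => t tn; rewrite /tailB !Fg; try lia.
have p_n := position_ltn gp tn; have p_peak := position_peak gp tn.
have := position_half gp tn; have [_ _ _ g_step] := path_steps gp tn.
move: (position g t) p_n p_peak => p p_n p_peak.
(* From [t - 1] to [t] only the class of [p] gains a letter, at the position with half [p./2]; in
   rows of the other class the two tails agree. *)
case: (eqVneq (peak i) (peak p)) => [pip|npip].
  rewrite (peak_half_eq pip) // pip; case: ifP => _ [e1 e2].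
    have key : ((i./2 == p./2) + (i./2 < g t.-1) = (i./2 < g t))%N.
      by rewrite e1 e2 !ltnS; case: ltngtP.
    by move/(congr1 (fun k => k%:R : R)): key; rewrite natrD; lra.
  have ge_half k : (k - i./2 <= g k)%N = (k - g k <= i./2)%N.
    by rewrite !leq_subLR addnC.
  have key : ((i./2 == p./2) + (t - i./2 <= g t) = (t.-1 - i./2 <= g t.-1))%N.
    by rewrite !ge_half e1 e2; case: ltngtP.
  by move/(congr1 (fun k => k%:R : R)): key; rewrite natrD; lra.
rewrite (_ : (i == p :> nat) = false); last first.
  by apply: contra_neqF npip => /eqP->.
move: p_peak npip; case: (boolP (peak i)) => _; case: (peak p) => // e _ [e1 e2].
  have -> : g t = g t.-1 by move: g_step e; clear; lia.
  by rewrite subrr.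
have -> : (t - i./2 <= g t)%N = (t.-1 - i./2 <= g t.-1)%N.
  by move: tn e; clear; lia.
by rewrite subrr.
Qed.

End Matrix.

Lemma palindromic_Btilde_123 (R : realType) :
  has_palindromic_hstar (Btilde_123 R n).
Proof.
have hi_ltn t : (t < n)%N -> (hiB t < n)%N by lia.
have n_le : (n <= n.+1)%N by [].
have lo_hi_n t : (t <= n)%N -> (n <= t)%N -> loB t = hiB t by lia.
have lo0 : loB 0 = 0%N /\ hiB 0 = 0%N by split; lia.
have lo_step t : (loB t <= loB t.+1 <= (loB t).+1)%N by lia.
have hi_step t : (hiB t <= hiB t.+1 <= (hiB t).+1)%N by lia.
have lo_hi t : (t <= n)%N -> (loB t <= hiB t)%N by lia.
have ex t k := @cell_exists n loB hiB hi_ltn t k.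
(* As before both covers raise the rank by one. The shift gives rank 1 to the cells with
   [t = k = uphalf n], and maximal cells satisfy [2k = t + 2], whence the greatest rank
   [uphalf n - 1]. *)
pose r (q : cellB) := (crow q + (uphalf n).+1 - (ccol q).*2)%N.
have rng (q : cellB) : [/\ uphalf (crow q) < ccol q, ccol q <= crow q,
    ccol q <= uphalf n & crow q < n]%N.
  by have /and3P[/= ? ? ?] := cellP q; split; lia.
apply: (@order_polytope_palindromic R n cellB (@cell_cov n _ _) r (uphalf n).-1
  _ _ _ _ _ (@PhiB R)).
- move=> p q; rewrite /cell_cov /r => pq.
  by have [] := rng p; have [] := rng q; case/orP: pq; lia.
- move=> q; have [q1 q2 q3 q4] := rng q; rewrite /r.
  case: (ltnP (ccol q) (crow q)) => kt.
    have [|p [p1 p2]] := ex (crow q).-1 (ccol q); first by rewrite /in_diagram; lia.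
    by right; exists p; rewrite /cell_cov p1 p2; lia.
  case: (ltnP (ccol q) (uphalf n)) => tn; last by left; lia.
  have [|p [p1 p2]] := ex (crow q).+1 (ccol q).+1; first by rewrite /in_diagram; lia.
  by right; exists p; rewrite /cell_cov p1 p2; lia.
- move=> q; have [q1 q2 q3 q4] := rng q; rewrite /r.
  case: (ltnP (crow q).+2 (ccol q).*2) => tn; last by left; lia.
  have [|p [p1 p2]] := ex (crow q).+1 (ccol q); first by rewrite /in_diagram; lia.
  by right; exists p; rewrite /cell_cov p1 p2; lia.
- by move=> q; have [q1 q2 q3 q4] := rng q; rewrite /r; lia.
(* For [n <= 2] the value [(uphalf n).-1] is 0; otherwise [(2, 2)] is a cell. *)
- case: (ltnP 2 n) => n2; last by lia.
  have [|p _] := ex 2%N 2%N; first by rewrite /in_diagram; lia.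
  by move=> Q0; have := card0_eq Q0 p; rewrite inE.
- exact: PhiB_linear.
- exact: PhiB_int.
- exact: PhiB_int_inv.
- move=> s; rewrite inE => /andP[alt av].
  have [g gp sg] := avoiding_path alt av.
  have [F fF Fg] := filter_of_path hi_ltn n_le lo_hi_n R gp.
  by exists F => //; apply: PhiB_perm gp sg Fg.
- move=> F fF; have [g gp Fg] := path_of_filter hi_ltn n_le lo_hi_n R
    lo0 lo_step hi_step lo_hi fF.
  have [s sX sg] := path_perm gp.
  by exists s; [rewrite inE|apply: PhiB_perm gp sg Fg].
Qed.

End CaseB.

Theorem theorem6p8 (R : realType) (n : nat) :
  has_palindromic_hstar (B_132_312 R n) /\
  has_palindromic_hstar (Btilde_123 R n).
Proof. by split; [exact: palindromic_B_132_312|exact: palindromic_Btilde_123]. Qed.
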